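(* Let $n\geq 1$ be an integer and consider the $L_p$-Minkowski equation $$\det(\nabla^2 h+h I)=f\,h^{p-1}\quad\text{on } \mathbb{S}^n .$$ (i) If $p=-n-1$, then there exists a positive function $f\in C^\alpha(\mathbb{S}^n)$ for some $\alpha\in(0,1)$ such that this equation admits no solution. (ii) If $p<-n-1$, then there exists a Hölder continuous function $f$ on $\mathbb{S}^n$ which is positive on $\mathbb{S}^n$ minus the two poles $\{\pm e_{n+1}\}$, such that this equation admits no solution.
   Context: $\mathbb{S}^n\subset\mathbb{R}^{n+1}$ is the unit sphere with its round metric; $\nabla^2 h$ is the covariant Hessian of $h$ with respect to an orthonormal frame, and $I$ is the identity matrix. A solution means a classical solution: a positive function $h\in C^2(\mathbb{S}^n)$ with $\nabla^2h+hI$ positive semidefinite (so that $h$ is the support function of a convex body containing the origin in its interior) satisfying the equation pointwise. $e_{n+1}=(0,\dots,0,1)$. *)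

(* Defs.v *)
From HB Require Import structures.
From mathcomp Require Import all_boot all_order all_algebra.
From mathcomp Require Import all_classical all_reals all_analysis.
Set Implicit Arguments. Unset Strict Implicit. Unset Printing Implicit Defensive.
Import Order.TTheory GRing.Theory Num.Theory.
Import numFieldNormedType.Exports.
Local Open Scope ring_scope.

Section Defs.
Variable R : realType.

Definition dotv (m : nat) (x y : 'rV[R]_m) : R := (x *m y^T) 0 0.
Definition enorm (m : nat) (x : 'rV[R]_m) : R := Num.sqrt (dotv x x).
Definition on_sphere (m : nat) (x : 'rV[R]_m) : Prop := dotv x x = 1.

Definition unitv (m : nat) (i : 'I_m) : 'rV[R]_m := delta_mx 0 i.

Definition ext0 (m : nat) (h : 'rV[R]_m -> R) : 'rV[R]_m -> R :=
  fun x => h ((enorm x)^-1 *: x).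

Definition pd (m : nat) (i : 'I_m) (g : 'rV[R]_m -> R) : 'rV[R]_m -> R :=
  fun x => 'D_(unitv i) g x.

Definition C2_nonzero (m : nat) (g : 'rV[R]_m -> R) : Prop :=
  forall x : 'rV[R]_m, x != 0 ->
    {for x, continuous g} /\
    forall i : 'I_m, derivable g x (unitv i) /\ {for x, continuous (pd i g)} /\
      forall j : 'I_m, derivable (pd i g) x (unitv j) /\
                       {for x, continuous (pd j (pd i g))}.

Definition hessmx (m : nat) (g : 'rV[R]_m -> R) (x : 'rV[R]_m) : 'M[R]_m :=
  \matrix_(i, j) pd j (pd i g) x.

(* Matrix of nabla^2 h + h I at x in the orthonormal frame of T_x S^n given by
   the columns of E (E^T E = I, x E = 0).  The covariant Hessian of h on the
   sphere equals the Euclidean Hessian of its 0-homogeneous extension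
   restricted to the tangent space. *)
Definition cov_mx (n : nat) (h : 'rV[R]_n.+1 -> R) (x : 'rV[R]_n.+1)
  (E : 'M[R]_(n.+1, n)) : 'M[R]_n :=
  E^T *m hessmx (ext0 h) x *m E + (h x)%:M.

Definition orth_frame (n : nat) (x : 'rV[R]_n.+1) (E : 'M[R]_(n.+1, n)) : Prop :=
  E^T *m E = 1%:M /\ x *m E = 0.

Definition psd (n : nat) (A : 'M[R]_n) : Prop :=
  forall v : 'rV[R]_n, 0 <= (v *m A *m v^T) 0 0.

Definition Lp_Minkowski_solution (n : nat) (p : R)
  (f h : 'rV[R]_n.+1 -> R) : Prop :=
  (forall x, on_sphere x -> 0 < h x) /\
  C2_nonzero (ext0 h) /\
  forall x E, on_sphere x -> orth_frame x E ->
    psd (cov_mx h x E) /\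
    \det (cov_mx h x E) = f x * powR (h x) (p - 1).

Definition holder_sphere (m : nat) (alpha : R) (f : 'rV[R]_m -> R) : Prop :=
  exists C : R, forall x y, on_sphere x -> on_sphere y ->
    `|f x - f y| <= C * powR (enorm (x - y)) alpha.

End Defs.

(* Main.v *)
(**
The proof is a Kazdan-Warner type obstruction.  Let [g] be the
0-homogeneous extension of the support function [h], [H = |x| g] its 1-homogeneous
extension, [w = H^2], [Y = grad (w / 2)] and [e = n + 1 + p].  Then
[det D^2 (w / 2) = g^(n+2) det (nabla^2 h + h I)], so the equation says
[det DY = J] with [J = f g^e] of degree 0.  For a function [X] of [w] with compact
support in [(0, oo)] and the last coordinate [x_l], the integrals over [R^(n+1)]
of [det (grad Y_0, .., grad (X Y_l))],
[d_l (X x_l J)] and [div (X L x)], [L = x_l Y_l J / w], vanish.  When [f] is a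
function [phi (t)] of [t = x_l^2 / |x|^2], a linear combination of them gives

  [\int X g^e (e (t - 1 / (n + 1)) phi (t) - 2 t (1 - t) phi' (t)) = 0],

which is impossible if the bracket is nonnegative and not identically zero.  For
[p = -n-1] take [phi (t) = 2 - t]; for [p < -n-1] take [phi (t) = (1 - t)^j] with
[2 j >= -e].

As [Y] is only of class C^1, the vanishing of the first integral cannot be
obtained by differentiating cofactors.  Integrals are replaced by limits of
Riemann sums on a grid of a torus, on which the determinant has a discrete
version summing exactly to 0.
*)
Require Import Defs.
From HB Require Import structures.
From mathcomp Require Import all_boot all_order all_algebra.
From mathcomp Require Import all_classical all_reals all_analysis.
From mathcomp Require Import perm ring lra zify.
Import Order.TTheory GRing.Theory Num.Theory.
Import numFieldNormedType.Exports.
Local Open Scope ring_scope.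
Set Implicit Arguments.
Unset Strict Implicit.
Unset Printing Implicit Defensive.

(** * An exact discrete null Lagrangian *)

Section Words.
Variables (R : comNzRingType) (I : finType).

Lemma big_tuple_cons k (F : seq I -> R) :
  \sum_(t : k.+1.-tuple I) F t = \sum_i \sum_(t : k.-tuple I) F (i :: t).
Proof.
rewrite pair_bigA /=.
rewrite (reindex (fun p : I * k.-tuple I => [tuple of p.1 :: p.2])) //=.
exists (fun t : k.+1.-tuple I => (thead t, [tuple of behead t])) => [[i t] _|t _] /=.
  by congr pair; apply: val_inj.
by rewrite [RHS]tuple_eta; apply: val_inj.
Qed.

Lemma big_tuple0 (F : seq I -> R) : \sum_(t : 0.-tuple I) F t = F [::].
Proof.
rewrite (eq_bigr (fun=> F [::])) => [|t _]; last by rewrite tuple0.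
by rewrite sumr_const card_tuple expn0.
Qed.

(** Antisymmetry is asked only under exchange of neighbouring letters and only on words of length
    [k]; such exchanges generate all permutations. *)
Definition alternating (k : nat) (eps : seq I -> R) :=
  forall p i j q, (size p + (size q).+2 = k)%N ->
    eps (p ++ i :: j :: q) = - eps (p ++ j :: i :: q).

Lemma alternating_cons k eps i :
  alternating k.+1 eps -> alternating k (fun s => eps (i :: s)).
Proof. by move=> ae p j j' q pq; apply: (ae (i :: p)); rewrite /= addSn pq. Qed.

Fixpoint word_prod (L : seq (I -> R)) (s : seq I) : R :=
  match L, s with
  | u :: L', i :: s' => u i * word_prod L' s'
  | [::], [::] => 1
  | _, _ => 0
  end.

(** By distributivity a sum over words of letterwise products splits into one sum per position, the
    positions being listed by [e]. It collapses the Leibniz formula in [sum_word_sign]. *)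
Lemma sum_word_prodM (T : Type) (e : seq T) (u v : T -> I -> R) :
  \sum_(t : (size e).-tuple I)
     word_prod [seq u k | k <- e] t * word_prod [seq v k | k <- e] t
  = \prod_(k <- e) \sum_i u k i * v k i.
Proof.
elim: e => [|k e IH] /=.
  by rewrite (big_tuple0 (fun t => word_prod [::] t * word_prod [::] t)) big_nil mulr1.
rewrite (big_tuple_cons _ (fun t => word_prod (u k :: [seq u k | k <- e]) t *
  word_prod (v k :: [seq v k | k <- e]) t)) big_cons -IH mulr_suml.
apply: eq_bigr => i _; rewrite mulr_sumr; apply: eq_bigr => t _ /=; ring.
Qed.

Variables (X : Type) (tau : I -> X -> X).

(* The value of the cup product of the coboundaries of the functions in [l] on
   the simplex whose vertices are visited from [x] along the steps [s]. *)
Fixpoint path_prod (l : seq (X -> R)) (s : seq I) (x : X) : R :=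
  match l, s with
  | a :: l', i :: s' => (a (tau i x) - a x) * path_prod l' s' (tau i x)
  | [::], [::] => 1
  | _, _ => 0
  end.

End Words.

Section Closed.
Variables (R : comNzRingType) (I : finType).
Hypothesis two_reg : forall x : R, x = - x -> x = 0.
Variables (X : Type) (tau : I -> X -> X).
Hypothesis tauC : forall i j x, tau i (tau j x) = tau j (tau i x).

(** Exchanging the first two letters changes the sign of [eps] and leaves [F] fixed, so the sum
    equals its own opposite. *)
Lemma alternating_sum0 k (eps : seq I -> R) (F : I -> I -> seq I -> R) :
  alternating k.+2 eps -> (forall i j s, F i j s = F j i s) ->
  \sum_i \sum_j \sum_(t : k.-tuple I) eps (i :: j :: t) * F i j t = 0.
Proof.
move=> ae Fsym; apply: two_reg; rewrite {1}exchange_big /= -sumrN.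
apply: eq_bigr => i _; rewrite -sumrN; apply: eq_bigr => j _; rewrite -sumrN.
apply: eq_bigr => t _; rewrite (ae [::] j i t) /= ?size_tuple //.
by rewrite Fsym mulNr.
Qed.

(** Discrete form of the closedness of a wedge product of exact forms: after antisymmetrisation,
    shifting the base point along the first letter has no effect. By induction on [l], both sides
    reduce to the opposite of one sum, with [a] and the remaining product taken at [tau i x]. *)
Lemma path_prod_closed (l : seq (X -> R)) (eps : seq I -> R) x :
  alternating (size l).+1 eps ->
  \sum_i \sum_(t : (size l).-tuple I) eps (i :: t) * path_prod tau l t (tau i x)
  = \sum_i \sum_(t : (size l).-tuple I) eps (i :: t) * path_prod tau l t x.
Proof.
elim: l eps x => [|a l IH] eps x ae /=.
  by apply: eq_bigr => i _; apply: eq_bigr => t _; rewrite tuple0.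
under eq_bigr => i _ do rewrite (big_tuple_cons _ (fun t =>
  eps (i :: t) * path_prod tau (a :: l) t (tau i x))) /=.
under [RHS]eq_bigr => i _ do rewrite (big_tuple_cons _ (fun t =>
  eps (i :: t) * path_prod tau (a :: l) t x)) /=.
have aei i : alternating (size l).+1 (fun s => eps (i :: s)) by exact: alternating_cons.
have swap (F : I -> seq I -> R) :
    \sum_i \sum_j \sum_(t : (size l).-tuple I) eps (i :: j :: t) * F j t
    = - \sum_i \sum_j \sum_(t : (size l).-tuple I) eps (i :: j :: t) * F i t.
  rewrite exchange_big /= -sumrN; apply: eq_bigr => i _; rewrite -sumrN.
  apply: eq_bigr => j _; rewrite -sumrN; apply: eq_bigr => t _.
  by rewrite (ae [::] j i t) /= ?size_tuple // mulNr.
(* The vertex reached after two steps is symmetric in them. *)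
have E0 := alternating_sum0 (F := fun i j s =>
  a (tau j (tau i x)) * path_prod tau l s (tau j (tau i x))) ae.
(* The induction hypothesis at the point [tau i x], for the words starting with [i], removes the
   shift by [j]. *)
have E1 : \sum_i \sum_j \sum_(t : (size l).-tuple I)
     eps (i :: j :: t) * (a (tau i x) * path_prod tau l t (tau j (tau i x)))
   = \sum_i \sum_j \sum_(t : (size l).-tuple I)
     eps (i :: j :: t) * (a (tau i x) * path_prod tau l t (tau i x)).
  apply: eq_bigr => i _.
  have := IH _ (tau i x) (aei i) => /(congr1 (fun z => a (tau i x) * z)).
  rewrite !mulr_sumr => H.
  under eq_bigr => j _ do under eq_bigr => t _ do rewrite mulrCA.
  under [RHS]eq_bigr => j _ do under eq_bigr => t _ do rewrite mulrCA.
  by under eq_bigr => j _ do rewrite -mulr_sumr; rewrite H;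
     apply: eq_bigr => j _; rewrite mulr_sumr.
(* As [a x] is a constant, the induction hypothesis leaves a summand free of [i] and [j], hence
   symmetric. *)
have E2 : \sum_i \sum_j \sum_(t : (size l).-tuple I)
     eps (i :: j :: t) * (a x * path_prod tau l t (tau j x)) = 0.
  under eq_bigr => i _ do under eq_bigr => j _ do under eq_bigr => t _ do rewrite mulrCA.
  under eq_bigr => i _ do under eq_bigr => j _ do rewrite -mulr_sumr.
  under eq_bigr => i _ do rewrite -mulr_sumr (IH _ x (aei i)) mulr_sumr.
  under eq_bigr => i _ do under eq_bigr => j _ do rewrite mulr_sumr.
  under eq_bigr => i _ do under eq_bigr => j _ do under eq_bigr => t _ do rewrite mulrCA.
  exact: (alternating_sum0 (F := fun i j s => a x * path_prod tau l s x) ae).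
have E3 := swap (fun i t => a (tau i x) * path_prod tau l t (tau i x)).
rewrite (eq_bigr (fun i => \sum_j (\sum_(t : (size l).-tuple I)
   eps (i :: j :: t) * (a (tau j (tau i x)) * path_prod tau l t (tau j (tau i x)))
   - \sum_(t : (size l).-tuple I)
     eps (i :: j :: t) * (a (tau i x) * path_prod tau l t (tau j (tau i x)))))); last first.
  move=> i _; apply: eq_bigr => j _; rewrite -sumrB; apply: eq_bigr => t _; ring.
rewrite [RHS](eq_bigr (fun i => \sum_j (\sum_(t : (size l).-tuple I)
   eps (i :: j :: t) * (a (tau j x) * path_prod tau l t (tau j x))
   - \sum_(t : (size l).-tuple I)
     eps (i :: j :: t) * (a x * path_prod tau l t (tau j x))))); last first.
  move=> i _; apply: eq_bigr => j _; rewrite -sumrB; apply: eq_bigr => t _; ring.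
under eq_bigr => i _ do rewrite sumrB.
under [RHS]eq_bigr => i _ do rewrite sumrB.
rewrite !sumrB E0 ?E1 ?E2 ?E3 ?sub0r ?subr0 // => i j s.
by rewrite tauC.
Qed.

End Closed.

(** Discrete Stokes formula. In the first difference, the part at [tau i x] is moved to [x] by
    reindexing along the bijection [tau i], the part at [x] loses its shift by [path_prod_closed],
    and the two cancel. *)
Lemma sum_path_prod0 (R : comNzRingType) (I X : finType) (tau : I -> X -> X)
    (a : X -> R) (l : seq (X -> R)) (eps : seq I -> R) :
  (forall x : R, x = - x -> x = 0) ->
  (forall i j x, tau i (tau j x) = tau j (tau i x)) ->
  (forall i, injective (tau i)) ->
  alternating (size l).+1 eps ->
  \sum_x \sum_(t : (size l).+1.-tuple I) eps t * path_prod tau (a :: l) t x = 0.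
Proof.
move=> two_reg tauC tau_inj ae.
under eq_bigr => x _ do rewrite (big_tuple_cons _ (fun t =>
  eps t * path_prod tau (a :: l) t x)) /=.
rewrite (eq_bigr (fun x =>
    \sum_i \sum_(t : (size l).-tuple I)
       eps (i :: t) * (a (tau i x) * path_prod tau l t (tau i x))
  - a x * \sum_i \sum_(t : (size l).-tuple I)
       eps (i :: t) * path_prod tau l t (tau i x))); last first.
  move=> x _; rewrite mulr_sumr -sumrB; apply: eq_bigr => i _.
  rewrite mulr_sumr -sumrB; apply: eq_bigr => t _; ring.
rewrite sumrB exchange_big /=.
under eq_bigr => i _ do rewrite -(reindex_inj (h := tau i) (P := xpredT) (F := fun x =>
  \sum_(t : (size l).-tuple I) eps (i :: t) * (a x * path_prod tau l t x)) (@tau_inj i)) /=.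
rewrite exchange_big /= -sumrB big1 // => x _.
rewrite (path_prod_closed two_reg tauC x ae) mulr_sumr -sumrB big1 // => i _.
rewrite mulr_sumr -sumrB big1 // => t _; ring.
Qed.

(** * The sign of a word and the Leibniz formula *)

Section WordSign.
Variables (R : comNzRingType) (m : nat).

(** On words of length [m.+1] this is the sign of [s] as a permutation, and 0 if a letter repeats.
    In determinant form, antisymmetry is an exchange of rows. *)
Definition word_sign (s : seq 'I_m.+1) : R :=
  \det (\matrix_(k, j) (nth ord0 s k == j)%:R : 'M[R]_m.+1).

Lemma word_sign_alternating : alternating m.+1 word_sign.
Proof.
move=> p i j q pq; rewrite /word_sign.
have lp : (size p < m.+1)%N by lia.
have lp1 : ((size p).+1 < m.+1)%N by lia.
set A := \matrix_(k, l) _; set B := \matrix_(k, l) (nth _ (p ++ j :: i :: q) _ == _)%:R.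
have -> : A = xrow (Ordinal lp) (Ordinal lp1) B.
  apply/matrixP => k l; rewrite !mxE !nth_cat.
  case: tpermP => [->|->|/eqP k1 /eqP k2] /=.
  - by rewrite ltnn subnn ltnNge leqnSn /= subSnn.
  - by rewrite ltnn subnn ltnNge leqnSn /= subSnn.
  - case: ltnP => // kp.
    have k1' : nat_of_ord k != size p by apply: contra k1 => /eqP e; apply/eqP/val_inj.
    have k2' : nat_of_ord k != (size p).+1 by apply: contra k2 => /eqP e; apply/eqP/val_inj.
    have : (1 < k - size p)%N.
      by rewrite ltn_subRL addn1 ltn_neqAle eq_sym k2' /= ltn_neqAle eq_sym k1'.
    by case: (k - size p)%N => [|[]].
rewrite xrowE det_mulmx det_perm odd_tperm.
have -> : Ordinal lp != Ordinal lp1.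
  by rewrite -val_eqE /= neq_ltn ltnSn.
by rewrite expr1 mulN1r.
Qed.

Lemma word_prod_enum (u : 'I_m.+1 -> 'I_m.+1 -> R) (s : seq 'I_m.+1) :
  size s = m.+1 ->
  word_prod [seq u k | k <- enum 'I_m.+1] s = \prod_k u k (nth ord0 s k).
Proof.
move=> sz.
have gen (e : seq 'I_m.+1) (t : seq 'I_m.+1) : size e = size t ->
   word_prod [seq u k | k <- e] t = \prod_(j < size e) u (nth ord0 e j) (nth ord0 t j).
  elim: e t => [|k e IH] [|i t] //= => [_|[et]]; first by rewrite big_ord0.
  by rewrite big_ord_recl /= IH.
rewrite gen ?size_enum_ord //.
rewrite -(big_mkord xpredT (fun j => u (nth ord0 (enum 'I_m.+1) j) (nth ord0 s j))).
rewrite big_mkord; apply: eq_bigr => k _.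
by rewrite nth_ord_enum.
Qed.

(** Once [word_sign t] is expanded over permutations, each permutation selects the single word that
    it spells, which leaves the Leibniz formula of [\det M]. *)
Lemma sum_word_sign (M : 'M[R]_m.+1) :
  \sum_(t : m.+1.-tuple 'I_m.+1)
     word_sign t * word_prod [seq (fun i => M k i) | k <- enum 'I_m.+1] t = \det M.
Proof.
rewrite /determinant.
under eq_bigr => t _.
  rewrite /word_sign /determinant mulr_suml.
  under eq_bigr => s _.
    rewrite -mulrA mulrC.
    under eq_bigr => k _ do rewrite mxE.
    rewrite -(word_prod_enum (fun k i => (i == s k)%:R)) ?size_tuple // mulrC.
    over.
  over.
rewrite exchange_big /=; apply: eq_bigr => s _; rewrite -mulr_sumr; congr (_ * _).
have := sum_word_prodM (enum 'I_m.+1) (fun k i => (i == s k)%:R) (fun k i => M k i).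
rewrite size_enum_ord => ->.
rewrite big_enum /=; apply: eq_bigr => k _.
rewrite (bigD1 (s k)) //= eqxx mul1r big1 ?addr0 // => i /negbTE ->.
by rewrite mul0r.
Qed.

End WordSign.

(** * The Hessian of the squared gauge in an orthonormal frame *)

Section Frame.
Variable R : realType.

(** The frame is formed by all columns but the first of an orthogonal matrix that sends [x] to the
    first basis vector. *)
Lemma orth_frame_exists (n : nat) (x : 'rV[R]_n.+1) :
  on_sphere x -> exists E : 'M[R]_(n.+1, n), orth_frame x E.
Proof.
move=> xS.
suff [Q [QQ xQ]] : exists Q : 'M[R]_n.+1, Q^T *m Q = 1%:M /\ x *m Q = unitv R ord0.
  exists (col' ord0 Q); split.
    apply/matrixP => i j; have /matrixP/(_ (lift ord0 i) (lift ord0 j)) := QQ.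
    rewrite !mxE (inj_eq (@lift_inj _ _)) => <-.
    by apply: eq_bigr => k _; rewrite !mxE.
  apply/rowP => j; have /rowP/(_ (lift ord0 j)) := xQ.
  rewrite !mxE /= => H; rewrite -[RHS]H.
  by apply: eq_bigr => k _; rewrite !mxE.
have [->|x_neq] := eqVneq x (unitv R ord0).
  by exists 1%:M; rewrite trmx1 !mulmx1.
(* The reflection exchanging [x] and the first basis vector. *)
pose v := x - unitv R ord0; pose q := dotv v v.
have q_neq0 : q != 0.
  rewrite /q /dotv mxE psumr_eq0; last by move=> i _; rewrite [v^T _ _]mxE -expr2 sqr_ge0.
  apply: contra x_neq => /allP q0; rewrite -subr_eq0 -/v; apply/eqP/rowP => i.
  have := q0 i (mem_index_enum i); rewrite /= [v^T _ _]mxE -expr2 sqrf_eq0 => /eqP ->.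
  by rewrite mxE.
have vvT : v *m v^T = q%:M by rewrite [LHS]mx11_scalar.
(* Both vectors have norm 1, so |x - e_0|^2 = 2 x.(x - e_0); hence the reflection moves [x] exactly
   to the basis vector. *)
have qE : q = 2 * (x *m v^T) 0 0.
  have eT : (unitv R ord0 : 'rV[R]_n.+1) *m (unitv R ord0)^T = 1%:M.
    by rewrite /unitv trmx_delta mul_delta_mx; apply/matrixP => i j; rewrite !mxE !ord1.
  have xT : x *m x^T = 1%:M by rewrite [LHS]mx11_scalar; congr (_%:M).
  have ex : (unitv R ord0 : 'rV[R]_n.+1) *m x^T = x *m (unitv R ord0)^T.
    by rewrite -[LHS]trmxK trmx_mul trmxK [x *m _]mx11_scalar tr_scalar_mx.
  rewrite /q /dotv /v linearB /= !mulmxBl !mulmxBr eT xT ex.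
  rewrite !mxE eqxx /=; ring.
have xv : x - v = unitv R ord0 by rewrite /v opprB addrC subrK.
move: vvT qE q_neq0; clearbody q; move: xv; clearbody v => xv vvT qE q_neq0.
exists (1%:M - (2 / q) *: (v^T *m v)); split.
  have QT : (1%:M - (2 / q) *: (v^T *m v))^T = 1%:M - (2 / q) *: (v^T *m v).
    by rewrite linearB /= linearZ /= trmx_mul trmxK trmx1.
  rewrite QT mulmxBl mul1mx !mulmxBr mulmx1 -!scalemxAl -!scalemxAr.
  rewrite mulmxA -[v^T *m v *m v^T]mulmxA vvT mul_mx_scalar -scalemxAl !scalerA.
  apply/matrixP => i j; rewrite !mxE; field.
  exact: q_neq0.
rewrite mulmxBr mulmx1 -scalemxAr mulmxA [x *m v^T]mx11_scalar mul_scalar_mx scalerA.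
have -> : 2 / q * (x *m v^T) 0 0 = 1.
  by rewrite mulrAC -qE divff.
by rewrite scale1r xv.
Qed.

(** Here [c], [G], [H] are the value, gradient and Hessian at [x] of a function of degree 0, with
    its Euler relations as last hypotheses; the left matrix is the Hessian of half the squared
    gauge. In the basis made of [x] and [E] its Schur complement is [c] times the matrix of the
    equation, and the corner contributes [c ^+ 2]. *)
Lemma det_gauge_hessian (n : nat) (x G : 'rV[R]_n.+1) (H : 'M[R]_n.+1)
    (E : 'M[R]_(n.+1, n)) (c : R) :
  c != 0 -> on_sphere x -> orth_frame x E ->
  G *m x^T = 0 -> x *m H = - G -> H *m x^T = - G^T ->
  \det ((c ^+ 2)%:M + (2 * c) *: (x^T *m G) + (2 * c) *: (G^T *m x) + (G^T *m G + c *: H))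
  = c ^+ n.+2 * \det (E^T *m H *m E + c%:M).
Proof.
move=> c0 xS [EE xE] Gx xH Hx; set A := (X in \det X = _).
have xx : x *m x^T = 1%:M by rewrite [LHS]mx11_scalar; congr (_%:M).
have xG : x *m G^T = 0 by rewrite -[LHS]trmxK trmx_mul trmxK Gx trmx0.
have Ex : E^T *m x^T = 0 by rewrite -trmx_mul xE trmx0.
pose Q : 'M[R]_(1 + n) := row_mx x^T E.
have QQ : Q^T *m Q = 1%:M.
  by rewrite tr_row_mx trmxK mul_col_row xx xE Ex EE -scalar_mx_block.
have xA : x *m A = c ^+ 2 *: x + c *: G.
  rewrite /A !mulmxDr -!scalemxAr mul_mx_scalar !mulmxA xx xG xH mul1mx !mul0mx.
  by apply/matrixP => i j; rewrite !mxE; ring.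
have EA : E^T *m A = c ^+ 2 *: E^T + (2 * c) *: ((G *m E)^T *m x) +
   ((G *m E)^T *m G + c *: (E^T *m H)).
  rewrite /A !mulmxDr -!scalemxAr mul_mx_scalar !mulmxA Ex mul0mx scaler0 addr0.
  by rewrite trmx_mul.
pose W := G *m E.
have QAQ : Q^T *m A *m Q = block_mx (c ^+ 2)%:M (c *: W) (c *: W^T)
    ((c ^+ 2)%:M + W^T *m W + c *: (E^T *m H *m E)).
  rewrite tr_row_mx trmxK mul_col_mx mul_col_row xA EA; congr block_mx.
  - by rewrite mulmxDl -!scalemxAl xx Gx scaler0 addr0 scalemx1.
  - by rewrite mulmxDl -!scalemxAl xE scaler0 add0r.
  - rewrite !mulmxDl -!scalemxAl -!mulmxA Ex xx Gx Hx !mulmx0 mulmx1.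
    rewrite mulmxN -trmx_mul -/W.
    by apply/matrixP => i j; rewrite !mxE; ring.
  - rewrite !mulmxDl -!scalemxAl -!mulmxA xE EE mulmx0 scaler0 addr0 scalemx1.
    by rewrite addrA.
have -> : \det A = \det (Q^T *m A *m Q).
  have : \det (Q^T *m Q) = 1 by rewrite QQ det1.
  rewrite !det_mulmx => dQ; by rewrite mulrAC dQ mul1r.
rewrite QAQ.
(* Block elimination: [L] has determinant 1 and clears the lower left block, and the two terms in
   [W^T *m W] cancel. *)
pose L : 'M[R]_(1 + n) := block_mx 1%:M 0 (- c^-1 *: W^T) 1%:M.
have -> : \det (block_mx (c ^+ 2)%:M (c *: W) (c *: W^T)
   ((c ^+ 2)%:M + W^T *m W + c *: (E^T *m H *m E))) =
   \det (L *m block_mx (c ^+ 2)%:M (c *: W) (c *: W^T)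
   ((c ^+ 2)%:M + W^T *m W + c *: (E^T *m H *m E))).
  by rewrite det_mulmx det_lblock !det1 mulr1 mul1r.
rewrite mulmx_block !mul1mx !mul0mx !addr0 mul_mx_scalar -scalemxAl -scalemxAr !scalerA.
have -> : c ^+ 2 * - c^-1 = - c by field.
have -> : - c^-1 * c = -1 by field.
rewrite scaleNr addNr scaleN1r det_ublock det_scalar expr1.
have -> : - (W^T *m W) + ((c ^+ 2)%:M + W^T *m W + c *: (E^T *m H *m E)) =
   c *: (E^T *m H *m E + c%:M).
  by apply/matrixP => i j; rewrite !mxE; ring.
by rewrite detZ mulrA -exprD addnC addn2.
Qed.

End Frame.

Local Open Scope classical_set_scope.

(** * Functions with continuous partial derivatives *)

Section Calculus.
Variables (R : realType) (m : nat).
Notation V := 'rV[R]_m.+1.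
Implicit Types (a b : V -> R) (x v : V).

Lemma coord_le_norm x j : `|x 0 j| <= `|x|.
Proof.
rewrite /Num.norm /= mx_normrE.
by apply: (le_trans _ (@le_bigmax _ _ _ 0 (fun ij => `|x ij.1 ij.2|) (0, j))).
Qed.

Lemma norm_le_coord x (c : R) : 0 <= c -> (forall j, `|x 0 j| <= c) -> `|x| <= c.
Proof.
move=> c0 H; rewrite /Num.norm /= mx_normrE; apply/bigmax_leP; split=> // -[i j] _ /=.
by rewrite (ord1 i).
Qed.

Lemma is_derive_line a x v (s d : R) :
  is_derive (s *: v + x) v a d -> is_derive s 1 (fun t : R => a (t *: v + x)) d.
Proof.
have E : (fun h : R => h^-1 *: (((fun t : R => a (t *: v + x)) \o shift s) (h *: (1 : R)) -
   a (s *: v + x))) = (fun h => h^-1 *: ((a \o shift (s *: v + x)) (h *: v) - a (s *: v + x))).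
  apply/funext => h /=; congr (_ *: (a _ - _)).
  by rewrite scalerDl addrA [(h *: 1)%R]mulr1.
by move=> [dv <-]; split; rewrite /derivable /derive E.
Qed.

(** Reduced to one variable on the line through [x] along [v], since [a] is assumed derivable in the
    direction [v] alone. *)
Lemma is_derive_comp (phi : R -> R) a x v (d d' : R) :
  is_derive (a x) 1 phi d' -> is_derive x v a d ->
  is_derive x v (fun y => phi (a y)) (d' * d).
Proof.
move=> dphi da.
have da0 : is_derive (0 : R) 1 (fun t : R => a (t *: v + x)) d.
  by apply: is_derive_line; rewrite scale0r add0r.
have dphi0 : is_derive (a ((0 : R) *: v + x)) 1 phi d' by rewrite scale0r add0r.
have [dv <-] := is_derive1_comp dphi0 da0.
have E : (fun h : R => h^-1 *: (((phi \o (fun t : R => a (t *: v + x))) \o shift 0) (h *: (1 : R)) -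
   (phi \o (fun t : R => a (t *: v + x))) 0)) =
   (fun h => h^-1 *: (((fun y => phi (a y)) \o shift x) (h *: v) - phi (a x))).
  apply/funext => h /=; congr (_ *: (phi (a _) - phi (a _))).
    by rewrite addr0 [(h *: 1)%R]mulr1.
  by rewrite scale0r add0r.
by split; [move: dv; rewrite /derivable | rewrite /derive]; rewrite E.
Qed.

Lemma mvt_line a x v (da : V -> R) (t : R) :
  (forall s : R, `|s| <= `|t| -> is_derive (s *: v + x) v a (da (s *: v + x))) ->
  exists2 c : R, `|c| <= `|t| & a (t *: v + x) - a x = t * da (c *: v + x).
Proof.
move=> H.
have dl (s : R) : `|s| <= `|t| ->
    is_derive s 1 (fun t : R => a (t *: v + x)) (da (s *: v + x)).
  by move=> st; apply: is_derive_line; exact: H.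
have cl (u w : R) : (forall s, s \in `[u, w]%R -> `|s| <= `|t|) ->
    {within `[u, w], continuous (fun t : R => a (t *: v + x))}.
  move=> uw; apply: derivable_within_continuous => s sI.
  by have [] := dl s (uw s sI).
have [t0|t0] := leP 0 t.
  have ii s : s \in `[0, t]%R -> `|s| <= `|t|.
    by rewrite in_itv /= => /andP[s0 st]; rewrite !ger0_norm.
  have dl' s : s \in `]0, t[%R -> is_derive s 1 (fun t : R => a (t *: v + x)) (da (s *: v + x)).
    by move=> sI; apply: dl; apply: ii; apply: subset_itv_oo_cc.
  have [c c0 Ec] := MVT_segment t0 dl' (cl 0 t ii).
  exists c; first exact: ii.
  by move: Ec; rewrite scale0r add0r subr0 mulrC.
have ii s : s \in `[t, 0]%R -> `|s| <= `|t|.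
  by rewrite in_itv /= => /andP[s0 st]; rewrite !ler0_norm // ?lerN2 // ltW.
have dl' s : s \in `]t, 0[%R -> is_derive s 1 (fun t : R => a (t *: v + x)) (da (s *: v + x)).
    by move=> sI; apply: dl; apply: ii; apply: subset_itv_oo_cc.
  have [c c0 Ec] := MVT_segment (ltW t0) dl' (cl t 0 ii).
exists c; first exact: ii.
by move: Ec; rewrite scale0r add0r sub0r => Ec; apply: oppr_inj; rewrite opprB Ec; ring.
Qed.

Lemma near_neq0 x : x != 0 -> \forall y \near x, y != 0.
Proof.
move=> x0; apply/nbhs_ballP; exists `|x|; first by rewrite /= normr_gt0.
move=> y; rewrite -ball_normE /= => xy; apply: contraTneq xy => ->.
by rewrite subr0 ltxx.
Qed.

(** The increment along [v] is split into moves parallel to the axes. The mean value theorem turns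
    each into a partial derivative at a point near [x], to which continuity at [x] applies. *)
Lemma is_derive_partial a (da : 'I_m.+1 -> V -> R) x v :
  (\forall y \near x, forall k, is_derive y (unitv R k) a (da k y)) ->
  (forall k, {for x, continuous (da k)}) ->
  is_derive x v a (\sum_k v 0 k * da k x).
Proof.
move=> dnear dcont.
suff H : (fun h : R => h^-1 *: ((a \o shift x) (h *: v) - a x)) @ (0 : R)^'
    --> \sum_k v 0 k * da k x.
  by split; [apply/cvg_ex; exists (\sum_k v 0 k * da k x) | apply: cvg_lim].
apply/cvgrPdist_le => /= e e0.
(* The added 1 keeps [C] positive when [v] is zero. *)
pose C := \sum_k `|v 0 k| + 1.
have C0 : 0 < C by rewrite ltr_wpDl // sumr_ge0.
have eC : 0 < e / C by rewrite divr_gt0.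
have near2 : \forall y \near x, forall k, `|da k x - da k y| <= e / C.
  apply: (@filter_forall V _ (fun k y => `|da k x - da k y| <= e / C) (nbhs x)) => k.
  by have /cvgrPdist_le /(_ _ eC) := dcont k.
have /nbhs_ballP[rho /= rho0 Hrho] : \forall y \near x,
    (forall k, is_derive y (unitv R k) a (da k y)) /\
    (forall k, `|da k x - da k y| <= e / C) by exact: filterI.
have D0 : 0 < `|v| + 1 by rewrite ltr_wpDl.
have : \forall h \near (0 : R)^', `|h| < rho / (`|v| + 1) /\ h != 0.
  apply: filterI; last exact: withinT.
  apply: nbhs_dnbhs; apply/nbhs_ballP; exists (rho / (`|v| + 1)); first exact: divr_gt0.
  by move=> h; rewrite -ball_normE /= sub0r normrN.
apply: filterS => h [hsmall h0] /=.
(* The staircase from [x] to [x + h *: v]: [z k] has moved in the coordinates of index below [k]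
   only. *)
pose z k := x + h *: \row_(j < m.+1) (if (j < k)%N then v 0 j else 0).
have zin (y : V) : (forall j, `|y 0 j| <= `|h| * `|v|) -> ball x rho (x + y).
  move=> yj; rewrite -ball_normE /= opprD addNKr normrN.
  apply: (@le_lt_trans _ _ (`|h| * `|v|)).
    by apply: norm_le_coord => //; rewrite mulr_ge0.
  apply: (@le_lt_trans _ _ (`|h| * (`|v| + 1))).
    by rewrite ler_wpM2l // lerDl.
  by rewrite -ltr_pdivlMr.
have step (k : 'I_m.+1) : exists2 xi, ball x rho xi &
    a (z k.+1) - a (z k) = h * v 0 k * da k xi.
  have Ez : z k.+1 = (h * v 0 k) *: unitv R k + z k.
    apply/rowP => j; rewrite !mxE /= ltnS leq_eqVlt.
    have [->|jk] := eqVneq j k; first by rewrite eqxx ltnn /=; ring.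
    by rewrite (negbTE (_ : nat_of_ord j != k)) //=; ring.
  have inb (s : R) : `|s| <= `|h * v 0 k| -> ball x rho (s *: unitv R k + z k).
    move=> sle; rewrite /z addrCA; apply: zin => j; rewrite !mxE /=.
    have [->|jk] := eqVneq j k.
      rewrite ltnn mulr1 mulr0 addr0; apply: (le_trans sle).
      by rewrite normrM ler_wpM2l // coord_le_norm.
    rewrite mulr0 add0r; case: ifP => _; last by rewrite mulr0 normr0 mulr_ge0.
    by rewrite normrM ler_wpM2l // coord_le_norm.
  have [c cle Ec] := @mvt_line a (z k) (unitv R k) (da k) (h * v 0 k)
    (fun s sle => (Hrho _ (inb s sle)).1 k).
  exists (c *: unitv R k + z k); first exact: inb.
  by rewrite Ez Ec.
have [xi Hxi] := choice (fun k => let: ex_intro2 y p q := step k in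
   ex_intro (fun y => ball x rho y /\ a (z k.+1) - a (z k) = h * v 0 k * da k y) y (conj p q)).
have Etel : a (h *: v + x) - a x = \sum_(k < m.+1) h * v 0 k * da k (xi k).
  rewrite -(eq_bigr _ (fun k _ => (Hxi k).2)).
  rewrite -(big_mkord xpredT (fun k => a (z k.+1) - a (z k))) telescope_sumr //.
  congr (a _ - a _); apply/rowP => j; rewrite !mxE ?ltn_ord; last by rewrite mulr0 addr0.
  by rewrite addrC.
rewrite Etel scaler_sumr -sumrB.
apply: (le_trans (ler_norm_sum _ _ _)).
apply: (@le_trans _ _ (\sum_k `|v 0 k| * (e / C))).
  apply: ler_sum => k _.
  have -> : v 0 k * da k x - h^-1 *: (h * v 0 k * da k (xi k)) =
     v 0 k * (da k x - da k (xi k)).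
    rewrite -[h^-1 *: _]/(h^-1 * _) -mulrA mulKf //; ring.
  by rewrite normrM ler_wpM2l //; exact: (Hrho _ (Hxi k).1).2.
rewrite -mulr_suml mulrA ler_pdivrMr // [_ * e]mulrC ler_wpM2l //; first exact: ltW.
by rewrite lerDl.
Qed.

(** The gradient is a parameter, so that explicit formulas for it are carried through sums, products
    and compositions. *)
Definition C1_on (U : V -> Prop) a (da : 'I_m.+1 -> V -> R) :=
  forall x, U x -> {for x, continuous a} /\
    forall i, is_derive x (unitv R i) a (da i x) /\ {for x, continuous (da i)}.

(** The derivative of [t |-> a (t *: x)] at 1 is computed once from the partial derivatives and once
    from the scaling law; [kappa] is the degree. *)
Lemma euler_homogeneous a (da : 'I_m.+1 -> V -> R) (theta : R -> R) (kappa : R) :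
  C1_on (fun x => x != 0) a da ->
  (forall c x, 0 < c -> x != 0 -> a (c *: x) = theta c * a x) ->
  is_derive (1 : R) 1 theta kappa ->
  forall x, x != 0 -> \sum_k x 0 k * da k x = kappa * a x.
Proof.
move=> Ca ha dtheta x x0.
have neq0 := near_neq0 x0.
have D1 : is_derive x x a (\sum_k x 0 k * da k x).
  apply: is_derive_partial; last by move=> k; have [_ /(_ k)[]] := Ca x x0.
  by apply: filterS neq0 => y /Ca[_ H] k; have [] := H k.
have D2 : is_derive (1 : R) 1 (fun t : R => a (t *: x + 0)) (\sum_k x 0 k * da k x).
  have D1' : is_derive (1 *: x) x a (\sum_k x 0 k * da k x) by rewrite scale1r.
  by apply: is_derive_line; rewrite addr0.
have D3 : is_derive (1 : R) 1 (fun t : R => a x *: theta t) (a x *: kappa).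
  exact: is_deriveZ.
have D4 : is_derive (1 : R) 1 (fun t : R => a x *: theta t) (\sum_k x 0 k * da k x).
  apply: near_eq_is_derive D2; near=> t; rewrite addr0 ha //; first by rewrite mulrC.
  by near: t; exact: lt_nbhsr.
by rewrite -(@derive_val _ _ _ _ _ _ _ D4) (@derive_val _ _ _ _ _ _ _ D3) mulrC.
Unshelve. all: by end_near. Qed.

End Calculus.

(** * Riemann sums of Jacobian determinants *)

Lemma cvg_sumr (R : realType) (T I : Type) (G : set_system T) (r : seq I)
    (f : I -> T -> R) (l : I -> R) : Filter G ->
  (forall i, f i @ G --> l i) ->
  (fun t => \sum_(i <- r) f i t) @ G --> \sum_(i <- r) l i.
Proof.
move=> FG fl; elim: r => [|i r IH].
  rewrite big_nil; under eq_fun do rewrite big_nil; exact: cvg_cst.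
rewrite big_cons; under eq_fun do rewrite big_cons.
exact: cvgD.
Qed.

Section DiffQuotient.
Variables (R : realType) (m : nat).
Notation V := 'rV[R]_m.+1.

Definition dquot (a : V -> R) (delta : R) (i : 'I_m.+1) (y : V) : R :=
  (a (delta *: unitv R i + y) - a y) / delta.

(** The rescaled [path_prod] in Euclidean space: each factor is taken at the vertex reached by the
    preceding steps, as the exact cancellation requires. *)
Fixpoint dquot_prod (l : seq (V -> R)) (s : seq 'I_m.+1) (delta : R) (y : V) : R :=
  match l, s with
  | a :: l', i :: s' => dquot a delta i y * dquot_prod l' s' delta (delta *: unitv R i + y)
  | [::], [::] => 1
  | _, _ => 0
  end.

Variables (T : Type) (G : set_system T) (FG : Filter G).
Variables (delta : T -> R).
Hypothesis delta_cvg : delta @ G --> (0 : R).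
Hypothesis delta_neq0 : \forall t \near G, delta t != 0.

Lemma dquot_cvg a (da : 'I_m.+1 -> V -> R) (y : T -> V) x i :
  C1_on (fun=> True) a da -> y @ G --> x ->
  (fun t => dquot a (delta t) i (y t)) @ G --> da i x.
Proof.
move=> Ca yx; apply/cvgrPdist_le => /= e e0.
have [_ /(_ i)[_ /cvgrPdist_le /(_ _ e0)]] := Ca x I.
move=> /nbhs_ballP[rho /= rho0 Hrho].
have r2 : 0 < rho / 2 by rewrite divr_gt0.
have /cvgrPdist_lt /(_ _ r2) yn := yx.
have /cvgrPdist_lt /(_ _ r2) dn := delta_cvg.
have H := @filterI _ G FG _ _ (@filterI _ G FG _ _ yn dn) delta_neq0.
apply: filterS H => t [[/= yt dt] d0].
rewrite sub0r normrN in dt.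
have [c cle Ec] := @mvt_line R m a (y t) (unitv R i) (da i) (delta t)
    (fun s _ => ((Ca (s *: unitv R i + y t) I).2 i).1).
rewrite /dquot Ec mulrC mulKf //; apply: Hrho.
rewrite -ball_normE /= opprD addrCA.
apply: (le_lt_trans (ler_normD _ _)).
apply: (@lt_le_trans _ _ (rho / 2 + rho / 2)); last by rewrite -splitr.
apply: ler_ltD => //; rewrite normrN normrZ.
apply: (@le_trans _ _ `|c|); last by rewrite (le_trans cle) // ltW.
rewrite ler_piMr //; apply: norm_le_coord => // j; rewrite mxE /=.
by case: (j == i); rewrite ?normr1 ?normr0.
Qed.

(** The base point and the step vary together; compactness later turns this joint limit into uniform
    convergence. *)
Lemma dquot_prod_cvg (S : Type) (e : seq S) (a : S -> V -> R)
    (da : S -> 'I_m.+1 -> V -> R) (y : T -> V) x s :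
  (forall k, C1_on (fun=> True) (a k) (da k)) -> y @ G --> x ->
  (fun t => dquot_prod [seq a k | k <- e] s (delta t) (y t)) @ G -->
    word_prod [seq (fun i => da k i x) | k <- e] s.
Proof.
move=> Ca; elim: e s y => [|k e IH] [|i s] y yx /=; try exact: cvg_cst.
apply: cvgM; first exact: dquot_cvg.
apply: IH; rewrite -[x]add0r; apply: cvgD => //.
by rewrite -(scale0r (unitv R i)); apply: cvgZr_tmp.
Qed.

Lemma word_prod_cvg (S : Type) (e : seq S)
    (da : S -> 'I_m.+1 -> V -> R) (y : T -> V) x s :
  (forall k i, {for x, continuous (da k i)}) -> y @ G --> x ->
  (fun t => word_prod [seq (fun i => da k i (y t)) | k <- e] s) @ G -->
    word_prod [seq (fun i => da k i x) | k <- e] s.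
Proof.
move=> Ca yx; elim: e s => [|k e IH] [|i s] /=; try exact: cvg_cst.
apply: cvgM => //.
by apply: (@cvg_comp _ _ _ y (da k i) _ (nbhs x)) => //; exact: Ca.
Qed.

End DiffQuotient.

(** * Riemann sums on a periodic grid *)

Section Grid.
Variables (R : realType) (m : nat) (M : R).
Notation V := 'rV[R]_m.+1.
Notation X N := 'rV['I_N.+2]_m.+1.

Definition mesh N : R := 2 * M / N.+2%:R.
Definition grid_pt N (x : X N) : V := \row_j (- M + mesh N * (x 0%R j : nat)%:R).
Definition grid_avg (g : V -> R) N : R :=
  (\sum_(x : X N) g (grid_pt x)) / N.+2%:R ^+ m.+1.

(** Stands for the vanishing of the integral over the cube of half side [M], expressed through
    Riemann averages. *)
Definition null_mean (g : V -> R) : Prop := grid_avg g @ \oo --> (0 : R).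

(** Addition is modulo [N.+2] in each coordinate: the grid is a torus, and its steps are commuting
    bijections. *)
Definition grid_step N (i : 'I_m.+1) (x : X N) : X N := delta_mx 0 i + x.

Lemma grid_stepC N i j (x : X N) :
  grid_step i (grid_step j x) = grid_step j (grid_step i x).
Proof. by rewrite /grid_step addrCA. Qed.

Lemma grid_step_inj N i : injective (@grid_step N i).
Proof. exact: addrI. Qed.

Lemma grid_step_coord N i (x : X N) j :
  (grid_step i x 0%R j : nat) = if j == i then ((x 0%R j).+1 %% N.+2)%N else x 0%R j.
Proof.
rewrite !mxE /=; case: (j == i) => /=.
  by [].
by rewrite add0n modn_small.
Qed.

Lemma grid_step_pt N i (x : X N) : ((x 0%R i).+1 < N.+2)%N ->
  grid_pt (grid_step i x) = mesh N *: unitv R i + grid_pt x.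
Proof.
move=> xi; apply/rowP => j; rewrite [LHS]mxE grid_step_coord !mxE /=.
have [->|ji] := eqVneq j i; last by rewrite mulr0 add0r.
rewrite modn_small // -natr1 /=; ring.
Qed.

Hypothesis M0 : 0 < M.

Lemma mesh_gt0 N : 0 < mesh N.
Proof. by rewrite /mesh divr_gt0 ?mulr_gt0. Qed.

Lemma mesh_cvg0 : mesh @ \oo --> (0 : R).
Proof.
rewrite -(mulr0 (2 * M)); apply: cvgM; first exact: cvg_cst.
have := @cvg_harmonic R.
move/(@cvg_comp _ _ _ S (@harmonic R) \oo \oo (nbhs (0:R))) => H.
by apply: H => A [n _ An]; exists n => // k /= nk; apply: An => /=; rewrite leqW.
Qed.

Lemma grid_pt_box N (x : X N) j : - M <= grid_pt x 0%R j <= M.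
Proof.
rewrite mxE lerDl mulr_ge0 ?ler0n ?(ltW (mesh_gt0 N)) //= addrC lerBlDr.
have -> : M + M = 2 * M by ring.
rewrite /mesh mulrAC ler_pdivrMr // ler_pM2l ?mulr_gt0 //.
by rewrite ler_nat ltnW.
Qed.

Lemma path_prod_grid (l : seq (V -> R)) N s (x : X N) :
  (forall j, x 0%R j + size l < N.+2)%N ->
  path_prod (@grid_step N) [seq a \o @grid_pt N | a <- l] s x
  = mesh N ^+ size l * dquot_prod l s (mesh N) (grid_pt x).
Proof.
elim: l s x => [|a l IH] [|i s] x /= Hx; rewrite ?expr0 ?mulr1 ?mulr0 //.
rewrite IH; last first.
  move=> j; rewrite grid_step_coord; case: eqP => _; last by have := Hx j; lia.
  by rewrite modn_small; have := Hx j; lia.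
rewrite grid_step_pt; last by have := Hx i; lia.
rewrite /dquot exprS.
have mN := mesh_gt0 N; field.
by rewrite gt_eqF.
Qed.

(** Close to the upper faces a path may wrap around the torus. There a point and its neighbour after
    one step both stay away from the origin, where compactly supported functions vanish, so wrapping
    does no harm. *)
Lemma grid_wrap N (x : X N) j i : m.+1%:R * mesh N <= M / 2 ->
  (N.+2 <= x 0%R j + m.+1)%N ->
  M / 2 <= `|grid_pt x| /\ M / 2 <= `|grid_pt (grid_step i x)|.
Proof.
move=> small xj.
have far (y : X N) : (N.+2 <= y 0%R j + m.+1)%N -> M / 2 <= grid_pt y 0 j.
  move=> yj; rewrite mxE.
  have : N.+2%:R * mesh N <= (y 0%R j + m.+1)%:R * mesh N.
    by rewrite ler_pM2r ?mesh_gt0 // ler_nat.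
  have -> : N.+2%:R * mesh N = 2 * M by rewrite /mesh mulrC divfK // pnatr_eq0.
  by rewrite natrD; move: small; lra.
have abs (y : X N) : M / 2 <= grid_pt y 0 j -> M / 2 <= `|grid_pt y|.
  by move=> h; apply: (le_trans h); rewrite (le_trans (ler_norm _)) // coord_le_norm.
split; first by apply: abs; exact: far.
have [lt|ge] := ltnP (x 0%R j).+1 N.+2.
  apply: abs; apply: far; rewrite grid_step_coord.
  case: eqP => _ //; rewrite modn_small //; lia.
have [ji|ji] := eqVneq j i; last first.
  by apply: abs; apply: far; rewrite grid_step_coord (negbTE ji).
(* Here the step wraps, and the coordinate becomes [- M]. *)
have xE : ((x 0%R j).+1 = N.+2)%N by apply/eqP; rewrite eqn_leq ge andbT; exact: ltn_ord.
apply: (le_trans _ (coord_le_norm _ j)).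
rewrite mxE grid_step_coord ji eqxx -{1}ji xE modnn mulr0 addr0 normrN.
by rewrite ger0_norm ?ltW //; move: M0; lra.
Qed.

Lemma card_grid N : #|{: X N}| = (N.+2 ^ m.+1)%N.
Proof. by rewrite card_mx mul1n card_ord. Qed.

Lemma derive_near0 (a : V -> R) x i d :
  (\forall y \near x, a y = 0) -> is_derive x (unitv R i) a d -> d = 0.
Proof.
move=> a0 H.
have [_ <-] : is_derive x (unitv R i) (cst 0 : V -> R) d by apply: near_eq_is_derive H.
by rewrite derive_cst.
Qed.

(* The Jacobian determinant is a null Lagrangian.  No second derivatives are
   available, so the integration by parts is done exactly on the grid, where
   [\det] is replaced by an antisymmetrised cup product of differences. *)
Lemma null_mean_det (a : 'I_m.+1 -> V -> R) (da : 'I_m.+1 -> 'I_m.+1 -> V -> R) :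
  (forall k, C1_on (fun=> True) (a k) (da k)) ->
  (forall y, M / 4 <= `|y| -> a ord0 y = 0) ->
  null_mean (fun y => \det (\matrix_(k, j) da k j y)).
Proof.
move=> Ca supp; apply/cvgrPdist_le => /= e e0.
pose Phi (d : R) y := \sum_(t : m.+1.-tuple 'I_m.+1)
  word_sign R t * dquot_prod [seq a k | k <- enum 'I_m.+1] t d y.
pose Det y := \det (\matrix_(k, j) da k j y).
have DetE y : Det y = \sum_(t : m.+1.-tuple 'I_m.+1)
    word_sign R t * word_prod [seq (fun i => da k i y) | k <- enum 'I_m.+1] t.
  rewrite /Det -sum_word_sign; apply: eq_bigr => t _; congr (_ * word_prod _ _).
  by apply: eq_map => k; apply/funext => i; rewrite mxE.
have box_compact : compact [set v : V | forall i, `[- M, M]%classic (v ord0 i)].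
  by apply: (@rV_compact _ _ (fun=> `[- M, M]%classic)) => i; exact: segment_compact.
move/compact_near_coveringP : box_compact => near_box.
(* Uniform convergence on the box follows from convergence at each point along the joint filter, by
   compactness. *)
have unif : \forall N \near \oo, [set v : V | forall i, `[- M, M]%classic (v ord0 i)] `<=`
    (fun y => `|Phi (mesh N) y - Det y| <= e).
  apply: near_box => x _.
  pose G := filter_prod (nbhs x) (\oo : set_system nat).
  have FG : Filter G by rewrite /G; exact: _.
  have y2x : (fun t : V * nat => t.1) @ G --> x by exact: cvg_fst.
  have d20 : (fun t : V * nat => mesh t.2) @ G --> (0 : R).
    by apply: (@cvg_comp _ _ _ snd mesh _ (\oo : set_system nat)); [exact: cvg_snd | exact: mesh_cvg0].
  have dneq : \forall t \near G, mesh t.2 != 0.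
    by apply: filterE => t; rewrite gt_eqF // mesh_gt0.
  have c1 : (fun t : V * nat => Phi (mesh t.2) t.1 - Det t.1) @ G --> (0 : R).
    have c2 : (fun t : V * nat => \sum_(w : m.+1.-tuple 'I_m.+1) word_sign R w *
          (dquot_prod [seq a k | k <- enum 'I_m.+1] w (mesh t.2) t.1
           - word_prod [seq (fun i => da k i t.1) | k <- enum 'I_m.+1] w)) @ G -->
        \sum_(w : m.+1.-tuple 'I_m.+1) word_sign R w *
        (word_prod [seq (fun i => da k i x) | k <- enum 'I_m.+1] w
         - word_prod [seq (fun i => da k i x) | k <- enum 'I_m.+1] w).
      apply: (@cvg_sumr _ _ _ G) => w; apply: cvgM; first exact: cvg_cst.
      apply: cvgB; first exact: dquot_prod_cvg.
      apply: (@word_prod_cvg R m _ G _ _ _ da (fun t => t.1) x w) => // k i.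
      by have [_ /(_ i)[]] := Ca k x I.
    rewrite big1 in c2; last by move=> w _; rewrite subrr mulr0.
    apply: cvg_trans c2; apply: near_eq_cvg; apply: filterE => t.
    rewrite DetE -sumrB; apply: eq_bigr => w _; ring.
  move/cvgrPdist_le : c1 => /(_ _ e0).
  by apply: filterS => t; rewrite sub0r normrN.
have small : \forall N \near \oo, m.+1%:R * mesh N <= M / 2.
  have : (fun N => m.+1%:R * mesh N) @ \oo --> (0 : R).
    by rewrite -(mulr0 (m.+1%:R)); apply: cvgM; [exact: cvg_cst|exact: mesh_cvg0].
  move/cvgr_le; apply; exact: divr_gt0.
move: unif; apply: filterS2 small => N small HN; rewrite sub0r normrN /grid_avg.
(* The discrete determinant on the torus, wrapping included; its sum over the grid is exactly 0. *)
pose P (x : X N) := \sum_(t : m.+1.-tuple 'I_m.+1) word_sign R t *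
   path_prod (@grid_step N) [seq b \o @grid_pt N | b <- [seq a k | k <- enum 'I_m.+1]] t x.
have P0 : \sum_x P x = 0.
  rewrite /P enum_ordSl /=.
  have H := @sum_path_prod0 R 'I_m.+1 (X N) (@grid_step N) (a ord0 \o @grid_pt N)
    [seq b \o @grid_pt N | b <- [seq a k | k <- [seq lift ord0 i | i <- enum 'I_m]]]
    (@word_sign R m).
  have sz : size [seq b \o @grid_pt N | b <- [seq a k | k <- [seq lift ord0 i | i <- enum 'I_m]]] = m.
    by rewrite 3!size_map size_enum_ord.
  rewrite sz in H; apply: H.
  - by move=> z; lra.
  - exact: grid_stepC.
  - exact: grid_step_inj.
  - exact: word_sign_alternating.
have dN := mesh_gt0 N.
(* Away from the upper faces no path wraps and the uniform estimate applies; close to them [P] and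
   [Det] both vanish, because [a ord0] does. *)
have close (x : X N) : `|Det (grid_pt x) - P x / mesh N ^+ m.+1| <= e.
  have [Hx|] := boolP [forall j, (x 0%R j + m.+1 < N.+2)%N].
    have -> : P x / mesh N ^+ m.+1 = Phi (mesh N) (grid_pt x).
      rewrite /P mulr_suml; apply: eq_bigr => t _.
      have sz2 : size [seq a k | k <- enum 'I_m.+1] = m.+1 by rewrite size_map size_enum_ord.
      rewrite path_prod_grid sz2; last by move=> j; exact: (forallP Hx j).
      by rewrite -mulrA [_ * _ / _]mulrC mulKf // expf_neq0 // gt_eqF.
    by rewrite distrC; apply: HN => j /=; rewrite in_itv /= grid_pt_box.
  rewrite negb_forall => /existsP[j]; rewrite -leqNgt => xj.
  have -> : P x = 0.
    rewrite /P big1 // => t _; rewrite enum_ordSl (tuple_eta t) /=; set i := thead t.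
    have [f1 f2] := grid_wrap i small xj.
    have M42 : M / 4 <= M / 2 by move: M0; lra.
    by rewrite (supp _ (le_trans M42 f1)) (supp _ (le_trans M42 f2)) subrr mul0r mulr0.
  have -> : Det (grid_pt x) = 0.
    rewrite /Det (expand_det_row _ ord0) big1 // => i _.
    rewrite mxE; suff -> : da ord0 i (grid_pt x) = 0 by rewrite mul0r.
    apply: (@derive_near0 (a ord0) (grid_pt x) i); last first.
      by have [_ /(_ i)[]] := Ca ord0 (grid_pt x) I.
    have [f1 _] := grid_wrap ord0 small xj.
    (* The gap between [M / 2] and [M / 4] gives a whole ball on which [a ord0] vanishes, hence a
       zero derivative. *)
    apply/nbhs_ballP; exists (M / 4); first exact: divr_gt0.
    move=> y; rewrite -ball_normE /= => xy; apply: supp.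
    have := ler_normB (grid_pt x - y) (- y); rewrite opprK subrK normrN.
    move: f1 xy; lra.
  by rewrite mul0r subr0 normr0; exact: ltW.
have -> : \sum_(x : X N) Det (grid_pt x) =
    \sum_(x : X N) (Det (grid_pt x) - P x / mesh N ^+ m.+1).
  by rewrite sumrB -mulr_suml P0 mul0r subr0.
rewrite normrM normfV normrX normr_nat ler_pdivrMr ?exprn_gt0 //.
apply: (le_trans (ler_norm_sum _ _ _)).
apply: (le_trans (ler_sum _ (fun x _ => close x))).
by rewrite sumr_const card_grid -[_ *+ _]mulr_natr natrX.
Qed.

End Grid.

(** * Null means of determinants and partial derivatives, and positivity *)

Section NullMean.
Variables (R : realType) (m : nat) (M : R).
Notation V := 'rV[R]_m.+1.
Notation X N := 'rV['I_N.+2]_m.+1.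

Lemma null_meanD (f g : V -> R) : null_mean M f -> null_mean M g ->
  null_mean M (fun x => f x + g x).
Proof.
move=> nf ng; rewrite /null_mean -[0]addr0.
have -> : grid_avg M (fun x => f x + g x) = grid_avg M f \+ grid_avg M g.
  by apply/funext => N; rewrite /grid_avg /= big_split mulrDl.
exact: cvgD.
Qed.

Lemma null_meanZ (c : R) (f : V -> R) : null_mean M f -> null_mean M (fun x => c * f x).
Proof.
move=> nf; rewrite /null_mean -(mulr0 c).
have -> : grid_avg M (fun x => c * f x) = (fun N => c * grid_avg M f N).
  by apply/funext => N; rewrite /grid_avg /= -mulr_sumr mulrA.
by apply: cvgM => //; exact: cvg_cst.
Qed.

Lemma null_mean_sum (r : seq 'I_m.+1) (f : 'I_m.+1 -> V -> R) :
  (forall k, null_mean M (f k)) -> null_mean M (fun x => \sum_(k <- r) f k x).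
Proof.
move=> nf; elim: r => [|k r IH].
  have -> : (fun x : V => \sum_(k <- [::]) f k x) = (fun x => 0 * f ord0 x).
    by apply/funext => x; rewrite big_nil mul0r.
  exact: null_meanZ.
have -> : (fun x : V => \sum_(k <- k :: r) f k x) = (fun x => f k x + \sum_(k <- r) f k x).
  by apply/funext => x; rewrite big_cons.
exact: null_meanD.
Qed.

Hypothesis M0 : 0 < M.

(** A transposition of rows brings the compactly supported function to the first place. *)
Lemma null_mean_det_row (l : 'I_m.+1) (a : 'I_m.+1 -> V -> R)
    (da : 'I_m.+1 -> 'I_m.+1 -> V -> R) :
  (forall k, C1_on (fun=> True) (a k) (da k)) ->
  (forall y, M / 4 <= `|y| -> a l y = 0) ->
  null_mean M (fun y => \det (\matrix_(k, j) da k j y)).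
Proof.
move=> Ca supp; pose s := tperm ord0 l.
have := @null_mean_det R m M M0 (fun k => a (s k)) (fun k => da (s k))
  (fun k => Ca (s k)) _.
rewrite /s tpermL => /(_ supp) /(null_meanZ ((-1) ^+ s)).
congr (null_mean M _); apply/funext => y.
have -> : \matrix_(k, j) da (tperm ord0 l k) j y = row_perm s (\matrix_(k, j) da k j y).
  by apply/matrixP => k j; rewrite !mxE.
by rewrite row_permE det_mulmx det_perm mulrA -signr_addb addbb mul1r.
Qed.

Lemma det_id_row (l : 'I_m.+1) (v : 'I_m.+1 -> R) :
  \det (\matrix_(i, j) (if i == l then v j else (i == j)%:R)) = v l.
Proof.
rewrite (expand_det_row _ l).
(* Cofactors along row [l] do not see that row, so they are those of the identity matrix. *)
have cofE j : cofactor (\matrix_(i, j) (if i == l then v j else (i == j)%:R)) l j = (l == j)%:R.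
  have -> : (l == j)%:R = (\adj (1%:M : 'M[R]_m.+1)) j l.
    by rewrite -[\adj _]mul1mx mul_mx_adj det1 mxE eq_sym.
  rewrite mxE /cofactor; congr (_ * \det _); apply/matrixP => i k.
  by rewrite !mxE eq_sym (negbTE (neq_lift _ _)).
rewrite (bigD1 l) //= cofE eqxx mulr1 mxE eqxx big1 ?addr0 // => j jl.
by rewrite cofE eq_sym (negbTE jl) mulr0.
Qed.

Lemma is_derive_coord (x v : V) k : is_derive x v (fun y : V => y 0 k) (v 0 k).
Proof.
have H : (fun h : R => h^-1 *: (((fun y : V => y 0 k) \o shift x) (h *: v) - x 0 k))
    @ (0 : R)^' --> v 0 k.
  apply: cvg_near_cst; near=> h; rewrite /= !mxE addrK -[_ *: _]/(_ * _) mulKf //.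
  by near: h; exact: nbhs_dnbhs_neq.
by split; [apply/cvg_ex; exists (v 0 k) | apply: cvg_lim].
Unshelve. all: by end_near. Qed.

Lemma C1_coord U k : C1_on U (fun x : V => x 0 k) (fun i _ => (k == i)%:R).
Proof.
move=> x _; split; first exact: coord_continuous.
move=> i; split; last exact: cst_continuous.
have -> : (k == i)%:R = (unitv R i) 0 k :> R by rewrite mxE eqxx.
exact: is_derive_coord.
Qed.

(** [da l] is the Jacobian determinant of the coordinate functions with the one of index [l]
    replaced by [a]. *)
Lemma null_mean_partial (l : 'I_m.+1) (a : V -> R) (da : 'I_m.+1 -> V -> R) :
  C1_on (fun=> True) a da ->
  (forall y, M / 4 <= `|y| -> a y = 0) ->
  null_mean M (da l).
Proof.
move=> Ca supp.
have := @null_mean_det_row l (fun k => if k == l then a else fun x => x 0 k)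
  (fun k => if k == l then da else fun i _ => (k == i)%:R).
rewrite eqxx => /(_ _ supp) H.
have -> : da l = (fun y => \det (\matrix_(k, j)
   (if k == l then da else fun i _ => (k == i)%:R) j y)).
  apply/funext => y; rewrite -(det_id_row l (fun j => da j y)).
  by congr (\det _); apply/matrixP => k j; rewrite !mxE; case: ifP.
apply: H => k; case: eqP => _ //; exact: C1_coord.
Qed.

(** Along the grids with [K * q] points per side, a fixed cell on which [g] exceeds [c] holds a
    fraction [K ^- m.+1] of the points, which bounds the averages from below. *)
Lemma not_null_mean_ge0 (g : V -> R) (x0 : V) :
  (forall x, 0 <= g x) -> {for x0, continuous g} -> 0 < g x0 ->
  (forall j, `|x0 0 j| < M) -> ~ null_mean M g.
Proof.
move=> g0 gc gx0 x0M nm.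
pose c := g x0 / 2.
have c0 : 0 < c by rewrite divr_gt0.
have /nbhs_ballP[rho /= rho0 Hrho] : \forall y \near x0, c < g y.
  by move/cvgr_gt : gc; apply; rewrite /c; lra.
(* The cube is cut into [K] slices per direction, so thin that the cell containing [x0] lies in the
   ball of radius [rho]. *)
have [K [K2 Krho]] : exists K, (2 <= K)%N /\ 2 * M / K%:R < rho.
  exists (Num.truncn (2 * M / rho)).+2; split => //.
  rewrite ltr_pdivrMr // [rho * _]mulrC -ltr_pdivrMr //.
  by apply: (lt_trans (truncnS_gt _)); rewrite ltr_nat.
have K0 : 0 < K%:R :> R by rewrite ltr0n; lia.
(* The index of the slice that contains the coordinate [j] of [x0]. *)
pose b j := Num.truncn ((x0 0 j + M) * K%:R / (2 * M)).
have M20 : 0 < 2 * M by rewrite mulr_gt0.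
have xlo j : 0 <= x0 0 j + M by have := x0M j; rewrite ltr_norml => /andP[]; lra.
have bK j : (b j < K)%N.
  rewrite /b -(ltr_nat R); apply: (@le_lt_trans _ _ ((x0 0 j + M) * K%:R / (2 * M))).
    rewrite truncn_le; apply: divr_ge0; [apply: mulr_ge0 => //; exact: xlo | exact: ltW].
  rewrite ltr_pdivrMr // mulrC ltr_pM2l //.
  by have := x0M j; rewrite ltr_norml => /andP[]; lra.
have blo j : (b j)%:R * (2 * M) / K%:R <= x0 0 j + M.
  rewrite ler_pdivrMr // -ler_pdivlMr //.
  rewrite truncn_le; apply: divr_ge0; [apply: mulr_ge0 => //; exact: xlo | exact: ltW].
have bhi j : x0 0 j + M < ((b j)%:R + 1) * (2 * M) / K%:R.
  by rewrite ltr_pdivlMr // -ltr_pdivrMr // natr1; exact: truncnS_gt.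
have lower q : (0 < q)%N -> c / K%:R ^+ m.+1 <= grid_avg M g (K * q).-2.
  move=> q0; set N := (K * q).-2.
  have NE : N.+2 = (K * q)%N by rewrite /N; move: K2 q0; nia.
  have q0R : 0 < q%:R :> R by rewrite ltr0n.
  pose cell (z : 'rV['I_q]_m.+1) : X N := \row_j inord (q * b j + z 0 j).
  have lt z j : (q * b j + (z : 'rV['I_q]_m.+1) 0%R j < N.+2)%N.
    rewrite NE; have := ltn_ord (z 0 j); have := bK j; nia.
  have cell_inj : injective cell.
    move=> z z' /rowP zz'; apply/rowP => j; apply: val_inj.
    by have := congr1 val (zz' j); rewrite !mxE /= !inordK //; lia.
  have close z : c <= g (grid_pt M (cell z)).
    apply/ltW/Hrho; rewrite -ball_normE /=; apply: le_lt_trans Krho.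
    apply: norm_le_coord; first by rewrite divr_ge0 // ltW.
    move=> j; rewrite !mxE inordK // /mesh NE natrM natrD natrM.
    have := blo j; have := bhi j.
    set B := (b j)%:R; set x := x0 0 j; set t := (z 0 j : nat)%:R.
    have t0 : 0 <= t by rewrite ler0n.
    have tq : t <= q%:R by rewrite ler_nat ltnW.
    have -> : 2 * M / (K%:R * q%:R) * (q%:R * B + t)
      = B * (2 * M) / K%:R + 2 * M / K%:R * (t / q%:R).
      by field; rewrite !gt_eqF.
    have -> : (B + 1) * (2 * M) / K%:R = B * (2 * M) / K%:R + 2 * M / K%:R by field; rewrite gt_eqF.
    have : 0 <= 2 * M / K%:R * (t / q%:R) <= 2 * M / K%:R.
      have MK : 0 <= 2 * M / K%:R by rewrite divr_ge0 // ltW.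
      rewrite mulr_ge0 ?divr_ge0 //= ?ler_piMr // ?ler_pdivrMr ?mul1r //; exact: ltW.
    rewrite ler_norml; set E := B * _ / _; set F := 2 * M / K%:R; set H := F * _; lra.
  have NER : N.+2%:R = K%:R * q%:R :> R by rewrite NE natrM.
  rewrite /grid_avg NER ler_pdivlMr ?exprn_gt0 ?mulr_gt0 // exprMn mulrA divfK ?expf_neq0 ?gt_eqF //.
  rewrite (bigID (fun x => x \in codom cell)) /=.
  apply: ler_wpDr; first exact: sumr_ge0.
  apply: (@le_trans _ _ (\sum_(x in codom cell) c)).
    rewrite sumr_const card_codom // card_mx mul1n card_ord.
    by rewrite -[c *+ _]mulr_natr natrX.
  by apply: ler_sum => x /codomP[z ->].
have [N0 _ HN0] : \forall N \near \oo, grid_avg M g N < c / K%:R ^+ m.+1.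
  by move/cvgr_lt : nm; apply; rewrite divr_gt0 // exprn_gt0.
(* Since [K] is at least 2, the index [(K * N0.+2).-2] is beyond [N0]. *)
have := lower N0.+2 isT; rewrite leNgt HN0 //=; nia.
Qed.

End NullMean.

(** * Derivatives of homogeneous functions *)

Section C1Algebra.
Variables (R : realType) (m : nat).
Notation V := 'rV[R]_m.+1.
Implicit Types (U : V -> Prop) (a b : V -> R) (da db : 'I_m.+1 -> V -> R).

Lemma C1_cst U (c : R) : C1_on U (fun _ : V => c) (fun _ _ => 0).
Proof.
move=> x _; split; first exact: cst_continuous.
by move=> i; split; [exact: is_derive_cst | exact: cst_continuous].
Qed.

Lemma C1D U a da b db : C1_on U a da -> C1_on U b db ->
  C1_on U (fun x => a x + b x) (fun i x => da i x + db i x).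
Proof.
move=> Ca Cb x Ux; have [ca Da] := Ca x Ux; have [cb Db] := Cb x Ux.
split; first exact: (continuousD ca cb).
move=> i; have [Dai cai] := Da i; have [Dbi cbi] := Db i.
by split; [exact: is_deriveD | exact: (continuousD cai cbi)].
Qed.

Lemma C1M U a da b db : C1_on U a da -> C1_on U b db ->
  C1_on U (fun x => a x * b x) (fun i x => a x * db i x + b x * da i x).
Proof.
move=> Ca Cb x Ux; have [ca Da] := Ca x Ux; have [cb Db] := Cb x Ux.
split; first exact: (continuousM ca cb).
move=> i; have [Dai cai] := Da i; have [Dbi cbi] := Db i.
split; first exact: is_deriveM.
exact: (continuousD (continuousM ca cbi) (continuousM cb cai)).
Qed.

Lemma C1_sum U (I : Type) (r : seq I) (a : I -> V -> R) (da : I -> 'I_m.+1 -> V -> R) :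
  (forall k, C1_on U (a k) (da k)) ->
  C1_on U (fun x => \sum_(k <- r) a k x) (fun i x => \sum_(k <- r) da k i x).
Proof.
move=> Ca; elim: r => [|k r IH].
  have -> : (fun x => \sum_(k <- [::]) a k x) = (fun _ : V => 0).
    by apply/funext => x; rewrite big_nil.
  have -> : (fun i x => \sum_(k <- [::]) da k i x) = (fun (_ : 'I_m.+1) (_ : V) => 0).
    by apply/funext => i; apply/funext => x; rewrite big_nil.
  exact: C1_cst.
have -> : (fun x => \sum_(k <- k :: r) a k x) = (fun x => a k x + \sum_(k <- r) a k x).
  by apply/funext => x; rewrite big_cons.
have -> : (fun i x => \sum_(k <- k :: r) da k i x) =
          (fun i x => da k i x + \sum_(k <- r) da k i x).
  by apply/funext => i; apply/funext => x; rewrite big_cons.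
exact: C1D.
Qed.

Lemma C1_comp U (phi dphi : R -> R) a da : C1_on U a da ->
  (forall x, U x -> is_derive (a x) 1 phi (dphi (a x)) /\ {for a x, continuous dphi}) ->
  C1_on U (fun x => phi (a x)) (fun i x => dphi (a x) * da i x).
Proof.
move=> Ca Cphi x Ux; have [ca Da] := Ca x Ux; have [dp cp] := Cphi x Ux.
split.
  apply: continuous_comp => //; apply/differentiable_continuous/derivable1_diffP.
  by have [] := dp.
move=> i; have [Dai cai] := Da i; split; first exact: is_derive_comp.
apply: (continuousM _ cai); exact: continuous_comp.
Qed.

Lemma C1_eq U a da b db : C1_on U a da -> (forall x, a x = b x) ->
  (forall i x, da i x = db i x) -> C1_on U b db.
Proof.
move=> Ca /funext <- E.
suff <- : da = db by [].
by apply/funext => i; apply/funext.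
Qed.

Lemma C1_eq_neq0 a da b db : C1_on (fun x => x != 0) a da ->
  (forall x, x != 0 -> a x = b x) ->
  (forall i x, x != 0 -> da i x = db i x) -> C1_on (fun x => x != 0) b db.
Proof.
move=> Ca E dE x x0; have [ca Da] := Ca x x0; have nx := near_neq0 x0.
have near_cont (f h : V -> R) : (forall y, y != 0 -> f y = h y) ->
    {for x, continuous f} -> {for x, continuous h}.
  move=> fh /cvgrPdist_lt cf; apply/(@cvgrPdist_lt _ _ _ _ (nbhs_filter x)) => e e0.
  have H : \forall y \near x, `|f x - f y| < e := cf e e0.
  by apply: filterS2 nx H => y y0 H; rewrite -!fh.
split; first exact: near_cont ca.
move=> i; have [Dai cai] := Da i; split; last exact: (near_cont _ _ (dE i)).
rewrite -dE //; apply: near_eq_is_derive Dai.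
by apply: filterS nx => y; exact: E.
Qed.

Lemma C1_extend a da (rho : R) : 0 < rho -> C1_on (fun x => x != 0) a da ->
  (forall x, `|x| < rho -> a x = 0 /\ forall i, da i x = 0) ->
  C1_on (fun=> True) a da.
Proof.
move=> rho0 Ca a0 x _; have [->|] := eqVneq x 0; last exact: Ca.
have n0 : \forall y \near (0 : V), `|y| < rho.
  apply/nbhs_ballP; exists rho => // y.
  by rewrite -ball_normE /= sub0r normrN.
have cont0 (f : V -> R) : (forall y, `|y| < rho -> f y = 0) -> {for 0, continuous f}.
  move=> f0; apply/(@cvgrPdist_lt _ _ _ _ (nbhs_filter (0 : V))) => e e0.
  by apply: filterS n0 => y yr; rewrite !f0 ?normr0 // subrr normr0.
split; first by apply: cont0 => y /a0[].
move=> i; split; last by apply: cont0 => y /a0[_].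
have z0 : `|0 : V| < rho by rewrite normr0.
have [_ ->] := a0 0 z0.
have D0 : is_derive (0 : V) (unitv R i) (cst 0 : V -> R) 0 by exact: is_derive_cst.
apply: near_eq_is_derive D0.
by apply: filterS n0 => y /a0[->].
Qed.

Lemma is_derive_of_line a (x v : V) (d : R) :
  is_derive (0 : R) 1 (fun t : R => a (t *: v + x)) d -> is_derive x v a d.
Proof.
have E : (fun h : R => h^-1 *: (((fun t : R => a (t *: v + x)) \o shift 0) (h *: (1 : R)) -
   a ((0 : R) *: v + x))) = (fun h => h^-1 *: ((a \o shift x) (h *: v) - a x)).
  apply/funext => h /=; rewrite scale0r add0r addr0.
  by rewrite [(h *: 1)%R]mulr1.
by move=> [dv <-]; split; [move: dv; rewrite /derivable|rewrite /derive]; rewrite E.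
Qed.

(** Differentiate [a y = theta c * a (c^-1 *: y)] at [y = c *: x]: a partial derivative loses one
    degree. *)
Lemma partial_homogeneous a da (theta : R -> R) :
  C1_on (fun x => x != 0) a da ->
  (forall c x, 0 < c -> x != 0 -> a (c *: x) = theta c * a x) ->
  forall c x i, 0 < c -> x != 0 -> da i (c *: x) = theta c / c * da i x.
Proof.
move=> Ca ha c x i c0 x0.
have cx0 : c *: x != 0 by rewrite scaler_eq0 negb_or gt_eqF.
have D1 : is_derive x (c^-1 *: unitv R i) a (c^-1 * da i x).
  have -> : c^-1 * da i x = \sum_k (c^-1 *: unitv R i) 0 k * da k x.
    rewrite (bigD1 i) //= !mxE !eqxx mulr1 big1 ?addr0 // => k ki.
    by rewrite !mxE (negbTE ki) andbF mulr0 mul0r.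
  apply: is_derive_partial; last by move=> k; have [_ /(_ k)[]] := Ca x x0.
  by apply: filterS (near_neq0 x0) => y /Ca[_ H] k; have [] := H k.
have D2 : is_derive (c *: x) (unitv R i) (fun y => a (c^-1 *: y)) (c^-1 * da i x).
  apply: is_derive_of_line.
  have -> : (fun t : R => a (c^-1 *: (t *: unitv R i + c *: x))) =
            (fun t => a (t *: (c^-1 *: unitv R i) + x)).
    apply/funext => t; rewrite scalerDr !scalerA mulVf ?gt_eqF // scale1r.
    by rewrite mulrC.
  by apply: is_derive_line; rewrite scale0r add0r.
have D3 := is_deriveZ (theta c) D2.
have [_ Dcx] := Ca _ cx0; have [Dcxi _] := Dcx i.
have D4 : is_derive (c *: x) (unitv R i) a (theta c *: (c^-1 * da i x)).
  apply: near_eq_is_derive D3; apply: filterS (near_neq0 cx0) => y y0 /=.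
  rewrite -[LHS]ha // ?scaler_eq0 ?negb_or ?invr_neq0 ?gt_eqF //.
  by rewrite scalerA mulfV ?gt_eqF // scale1r.
rewrite -(@derive_val _ _ _ _ _ _ _ Dcxi) (@derive_val _ _ _ _ _ _ _ D4).
by rewrite -[_ *: _]/(_ * _) mulrA.
Qed.

End C1Algebra.

(** * The squared gauge, its gradient and its Hessian *)

Section Gauge.
Variables (R : realType) (m : nat).
Notation V := 'rV[R]_m.+1.
Implicit Type x : V.
Variable g : V -> R.
Hypothesis g_C2 : C2_nonzero g.
Hypothesis g_homog : forall (c : R) (x : V), 0 < c -> x != 0 -> g (c *: x) = g x.

Local Notation G k := (pd k g).
Local Notation Hs k j := (pd j (pd k g)).
Local Notation nz := (fun x : V => x != 0).

Definition sqn (x : V) : R := \sum_k x 0 k ^+ 2.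

(* With [H = |x| g] the 1-homogeneous extension of the support function:
   [gauge2] is [H^2], [half_grad] the gradient of [H^2 / 2]. *)
Definition gauge2 (x : V) : R := sqn x * g x ^+ 2.
Definition half_grad k (x : V) : R := x 0 k * g x ^+ 2 + sqn x * g x * G k x.
Definition half_hess k j (x : V) : R :=
  (k == j)%:R * g x ^+ 2 + 2 * x 0 k * g x * G j x + 2 * x 0 j * g x * G k x
  + sqn x * (G j x * G k x + g x * Hs k j x).

Lemma g_C1 : C1_on nz g (fun k => G k).
Proof.
move=> x x0; have [cg Dg] := g_C2 x0; split=> // i; have [di [ci _]] := Dg i.
by split => //; exact: derivableP.
Qed.

Lemma G_C1 k : C1_on nz (G k) (fun j => Hs k j).
Proof.
move=> x x0; have [_ Dg] := g_C2 x0; have [_ [ci Dj]] := Dg k; split; first exact: ci.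
by move=> i; have [dk ck] := Dj i; split; [exact: derivableP | exact: ck].
Qed.

Lemma sqn_C1 U : C1_on U sqn (fun k x => 2 * x 0 k).
Proof.
rewrite /sqn; apply: C1_eq (C1_sum _ (fun k => C1M (C1_coord k) (C1_coord k))) _ _ => [x|i x] /=.
  by apply: eq_bigr.
rewrite (bigD1 i) //= eqxx big1; first by rewrite addr0 !mulr1; ring.
by move=> k /negbTE ->; rewrite mulr0 addr0.
Qed.

Lemma gauge2_C1 : C1_on nz gauge2 (fun k x => 2 * half_grad k x).
Proof.
apply: C1_eq (C1M (@sqn_C1 nz) (C1M g_C1 g_C1)) _ _ => [x|i x] //.
rewrite /half_grad; ring.
Qed.

Lemma half_grad_C1 k : C1_on nz (half_grad k) (fun j => half_hess k j).
Proof.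
apply: C1_eq (C1D (C1M (@C1_coord R m nz k) (C1M g_C1 g_C1))
  (C1M (C1M (@sqn_C1 nz) g_C1) (G_C1 k))) _ _ => [x|i x] //.
rewrite /half_hess; ring.
Qed.

Lemma euler_g x : x != 0 -> \sum_k x 0 k * G k x = 0.
Proof.
move=> x0; rewrite (euler_homogeneous (theta := fun=> 1) (kappa := 0) g_C1) ?mul0r //.
by move=> c y c0 y0; rewrite mul1r g_homog.
Qed.

Lemma G_homog k (c : R) x : 0 < c -> x != 0 -> G k (c *: x) = c^-1 * G k x.
Proof.
move=> c0 x0; rewrite (partial_homogeneous (theta := fun=> 1) g_C1) ?div1r //.
by move=> c' y c'0 y0; rewrite mul1r g_homog.
Qed.

Lemma euler_G k x : x != 0 -> \sum_j x 0 j * Hs k j x = - G k x.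
Proof.
move=> x0.
have D : is_derive (1 : R) 1 (fun c : R => c^-1) (-1).
  have := @is_deriveV R id 1 1 1 (oner_neq0 _) (is_derive_id _ _).
  by rewrite expr1n invr1 scaleN1r.
by rewrite (euler_homogeneous (G_C1 k) (fun c y => @G_homog k c y) D x0) mulN1r.
Qed.

Lemma Hs_homog k j (c : R) x : 0 < c -> x != 0 -> Hs k j (c *: x) = c ^- 2 * Hs k j x.
Proof.
move=> c0 x0; rewrite (partial_homogeneous (theta := fun c : R => c^-1) (G_C1 k)) //.
  by rewrite -invfM -expr2.
by move=> c' y; exact: G_homog.
Qed.

(** Obtained by differentiating [euler_g], whereas [euler_G] is the Euler relation of [G k].
    Together they contract the Hessian on either index without appeal to its symmetry. *)
Lemma euler_grad x j : x != 0 -> \sum_k x 0 k * Hs k j x = - G j x.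
Proof.
move=> x0.
have C := C1_sum (index_enum 'I_m.+1) (fun k => C1M (@C1_coord R m nz k) (G_C1 k)).
have C0 : C1_on nz (fun _ : V => 0) (fun i x =>
    \sum_(k <- index_enum 'I_m.+1) (x 0 k * Hs k i x + G k x * (k == i)%:R)).
  by apply: C1_eq_neq0 C _ _ => // y y0; exact: euler_g.
have [_ /(_ j)[D _]] := C0 x x0.
have [_ ] := D; rewrite derive_cst big_split /= => /esym/eqP; rewrite addr_eq0 => /eqP ->.
rewrite (bigD1 j) //= eqxx mulr1 big1 ?addr0 // => k /negbTE ->.
by rewrite mulr0.
Qed.

Lemma sum_half_grad x : x != 0 -> \sum_k x 0 k * half_grad k x = gauge2 x.
Proof.
move=> x0; rewrite /half_grad.
rewrite (eq_bigr (fun k => x 0 k ^+ 2 * g x ^+ 2 + sqn x * g x * (x 0 k * G k x)));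
  last by move=> k _; ring.
by rewrite big_split /= -mulr_suml -mulr_sumr euler_g // mulr0 addr0.
Qed.

(** The Euler relation that writes the gradient of [gauge2] as a combination of the rows of the
    Hessian. *)
Lemma half_grad_row x j : x != 0 -> \sum_k x 0 k * half_hess k j x = half_grad j x.
Proof.
move=> x0; rewrite /half_grad /half_hess.
rewrite (eq_bigr (fun k => x 0 k * (k == j)%:R * g x ^+ 2 + 2 * g x * G j x * x 0 k ^+ 2
   + (2 * x 0 j * g x + sqn x * G j x) * (x 0 k * G k x)
   + sqn x * g x * (x 0 k * Hs k j x))); last by move=> k _; ring.
rewrite !big_split /= -!mulr_sumr -mulr_suml euler_g // euler_grad // -/(sqn x).
rewrite (bigD1 j) //= eqxx big1 => [|k /negbTE ->]; last by rewrite mulr0.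
rewrite mulr1; ring.
Qed.

Lemma sqnZ (c : R) x : sqn (c *: x) = c ^+ 2 * sqn x.
Proof.
by rewrite /sqn mulr_sumr; apply: eq_bigr => k _; rewrite mxE exprMn.
Qed.

Lemma sqn_gt0 x : x != 0 -> 0 < sqn x.
Proof.
move=> x0; rewrite lt_def sumr_ge0 ?andbT; last by move=> k _; exact: sqr_ge0.
apply: contra x0 => /eqP s0; apply/eqP/rowP => k; rewrite mxE; apply/eqP.
rewrite -sqrf_eq0; apply/eqP.
by have /(psumr_eq0P (fun i _ => sqr_ge0 _)) := s0; apply.
Qed.

Lemma half_hess_homog k j (c : R) x : 0 < c -> x != 0 ->
  half_hess k j (c *: x) = half_hess k j x.
Proof.
move=> c0 x0; rewrite /half_hess sqnZ (Hs_homog k j c0 x0) (G_homog k c0 x0) (G_homog j c0 x0).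
rewrite (g_homog c0 x0) !mxE.
by field; rewrite gt_eqF.
Qed.

End Gauge.

(** * Cutoff functions and bounds *)

Section Cutoff.
Variable R : realType.
Implicit Types s w : R.

(** Cutoffs of class C^1 suffice, and the square of the positive part provides them. *)
Definition sqpos (s : R) : R := Num.max 0 s ^+ 2.
Definition dsqpos (s : R) : R := 2 * Num.max 0 s.

Lemma sqpos_neg s : s <= 0 -> sqpos s = 0.
Proof. by move=> s0; rewrite /sqpos max_l // expr0n. Qed.

Lemma sqpos_pos s : 0 <= s -> sqpos s = s ^+ 2.
Proof. by move=> s0; rewrite /sqpos max_r. Qed.

Lemma dsqpos_neg s : s <= 0 -> dsqpos s = 0.
Proof. by move=> s0; rewrite /dsqpos max_l // mulr0. Qed.

Lemma dsqpos_pos s : 0 <= s -> dsqpos s = 2 * s.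
Proof. by move=> s0; rewrite /dsqpos max_r. Qed.

Lemma dsqpos_continuous : continuous dsqpos.
Proof.
move=> s.
have c2 : {for s, continuous (fun _ : R => 2 : R)} by exact: cst_continuous.
have cm : {for s, continuous (fun t : R => Num.max 0 t)}.
  by apply: continuous_max; [exact: cst_continuous | exact: cvg_id].
exact: (continuousM c2 cm).
Qed.

Lemma is_derive_sqpos s : is_derive s 1 sqpos (dsqpos s).
Proof.
have [s0|s0|s0] := ltgtP s 0.
- rewrite dsqpos_neg ?ltW //.
  apply: (near_eq_is_derive _ (is_derive_cst 0 s 1)); near=> y.
  rewrite sqpos_neg //; apply: ltW; near: y; exact: lt_nbhsl.
- rewrite dsqpos_pos ?ltW //.
  have D : is_derive s 1 (fun y : R => y ^+ 2) (2 * s).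
    have := exp_derive 2 s 1; rewrite /= expr1 [_ *: 1]mulr1 => E.
    by split; [exact: exprn_derivable | rewrite E].
  apply: near_eq_is_derive D; near=> y.
  rewrite sqpos_pos //; apply: ltW; near: y; exact: lt_nbhsr.
- rewrite s0 dsqpos_neg //.
  suff H : (fun h : R => h^-1 *: ((sqpos \o shift 0) (h *: (1 : R)) - sqpos 0)) @ (0 : R)^'
      --> (0 : R) by split; [apply/cvg_ex; exists 0 | apply: cvg_lim].
  apply/cvgrPdist_le => e e0; near=> h.
  rewrite sub0r normrN /= addr0 [h *: 1]mulr1 (@sqpos_neg 0) // subr0.
  apply: (@le_trans _ _ `|h|); last first.
    near: h; apply: nbhs_dnbhs; apply/nbhs_ballP; exists e => // y.
    by rewrite -ball_normE /= sub0r normrN => /ltW.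
  have [h0|h0] := leP h 0; first by rewrite sqpos_neg // scaler0 normr0.
  by rewrite (sqpos_pos (ltW h0)) -[_ *: _]/(_ * _) expr2 mulKf // gt_eqF.
Unshelve. all: by end_near. Qed.

Definition bump (w : R) : R := sqpos ((w - 1) * (2 - w)).
Definition dbump (w : R) : R := dsqpos ((w - 1) * (2 - w)) * (3 - 2 * w).
(* [plateau] is 1 on the support of [bump] and 0 near 0: multiplying the other
   entries of a determinant by it makes them C^1 at the origin at no cost. *)
Definition plateau (w : R) : R := sqpos (1 - 4 * sqpos (1 - w)).
Definition dplateau (w : R) : R := dsqpos (1 - 4 * sqpos (1 - w)) * (4 * dsqpos (1 - w)).

Lemma is_derive_affine (a b w : R) : is_derive w 1 (fun w : R => a - b * w) (- b).
Proof.
have D := is_deriveB (is_derive_cst a w (1 : R)) (is_deriveZ b (is_derive_id w (1 : R))).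
by apply: (is_derive_eq D); rewrite sub0r [_ *: _]mulr1.
Qed.

Lemma is_derive_bump_arg w : is_derive w 1 (fun w : R => (w - 1) * (2 - w)) (3 - 2 * w).
Proof.
have D1 := is_deriveB (is_derive_id w (1 : R)) (is_derive_cst (1 : R) w 1).
have D2 := is_deriveB (is_derive_cst (2 : R) w 1) (is_derive_id w (1 : R)).
apply: (is_derive_eq (is_deriveM D1 D2)).
by rewrite !fctE -![_ *: _]/(_ * _); ring.
Qed.

Lemma is_derive_bump w : is_derive w 1 bump (dbump w).
Proof. exact: (@is_derive1_comp _ sqpos _ w _ _ (is_derive_sqpos _) (is_derive_bump_arg w)). Qed.

Lemma is_derive_plateau_arg w :
  is_derive w 1 (fun w : R => 1 - 4 * sqpos (1 - w)) (4 * dsqpos (1 - w)).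
Proof.
have D1 : is_derive w 1 (fun w : R => 1 - w) (-1).
  have := is_deriveB (is_derive_cst (1 : R) w 1) (is_derive_id w (1 : R)).
  by rewrite sub0r.
have D2 := @is_derive1_comp _ sqpos (fun w => 1 - w) w _ _ (is_derive_sqpos (1 - w)) D1.
apply: (is_derive_eq (is_deriveB (is_derive_cst (1 : R) w 1) (is_deriveZ 4 D2))).
by rewrite -[_ *: _]/(_ * _); ring.
Qed.

Lemma is_derive_plateau w : is_derive w 1 plateau (dplateau w).
Proof. exact: (@is_derive1_comp _ sqpos _ w _ _ (is_derive_sqpos _) (is_derive_plateau_arg w)). Qed.

Lemma derivable_continuous (f : R -> R) (x d : R) : is_derive x 1 f d -> {for x, continuous f}.
Proof. by move=> [D _]; apply/differentiable_continuous/derivable1_diffP. Qed.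

Lemma dbump_continuous : continuous dbump.
Proof.
move=> w.
have c1 : {for w, continuous (fun w : R => (w - 1) * (2 - w))}.
  exact: (@derivable_continuous (fun w => (w - 1) * (2 - w)) _ _ (is_derive_bump_arg w)).
have c2 : {for w, continuous (fun w : R => dsqpos ((w - 1) * (2 - w)))}.
  exact: (continuous_comp c1 (@dsqpos_continuous _)).
have c3 : {for w, continuous (fun w : R => 3 - 2 * w)}.
  exact: (@derivable_continuous (fun w => 3 - 2 * w) _ _ (is_derive_affine 3 2 w)).
exact: (continuousM c2 c3).
Qed.

Lemma dplateau_continuous : continuous dplateau.
Proof.
move=> w.
have c1 : {for w, continuous (fun w : R => 1 - w)}.
  exact: (@derivable_continuous (fun w => 1 - w) _ _
    (is_deriveB (is_derive_cst (1 : R) w 1) (is_derive_id w (1 : R)))).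
have c2 : {for w, continuous (fun w : R => dsqpos (1 - w))}.
  exact: (continuous_comp c1 (@dsqpos_continuous _)).
have c3 : {for w, continuous (fun w : R => dsqpos (1 - 4 * sqpos (1 - w)))}.
  have c := @derivable_continuous (fun w => 1 - 4 * sqpos (1 - w)) _ _ (is_derive_plateau_arg w).
  exact: (continuous_comp c (@dsqpos_continuous _)).
have c4 : {for w, continuous (fun _ : R => 4 : R)} by exact: cst_continuous.
exact: (continuousM c3 (continuousM c4 c2)).
Qed.

Lemma bump_out w : ~~ (1 < w < 2) -> bump w = 0 /\ dbump w = 0.
Proof.
move=> nw; have le0 : (w - 1) * (2 - w) <= 0.
  move: nw; rewrite negb_and -!leNgt => /orP[]; nra.
by rewrite /bump /dbump sqpos_neg // dsqpos_neg // mul0r.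
Qed.

Lemma bump_ge0 w : 0 <= bump w.
Proof. exact: sqr_ge0. Qed.

Lemma bump_3_2 : 0 < bump (3 / 2).
Proof. rewrite /bump sqpos_pos; [apply: exprn_gt0|]; lra. Qed.

Lemma plateau_one w : 1 <= w -> plateau w = 1 /\ dplateau w = 0.
Proof.
move=> w1; rewrite /plateau /dplateau (@sqpos_neg (1 - w)) ?subr_le0 //.
rewrite (@dsqpos_neg (1 - w)) ?subr_le0 // mulr0 subr0 !mulr0 sqpos_pos //.
by rewrite expr1n.
Qed.

Lemma plateau_zero w : w <= 1 / 2 -> plateau w = 0 /\ dplateau w = 0.
Proof.
move=> w1; have : 1 - 4 * sqpos (1 - w) <= 0 by rewrite sqpos_pos; nra.
by move=> le0; rewrite /plateau /dplateau sqpos_neg // dsqpos_neg // mul0r.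
Qed.

End Cutoff.

(** * Two-sided bounds on the gauge *)

Section Bounds.
Variables (R : realType) (m : nat).
Notation V := 'rV[R]_m.+1.
Implicit Type x : V.
Variable g : V -> R.
Hypothesis g_cont : forall x, x != 0 -> {for x, continuous g}.
Hypothesis g_homog : forall (c : R) (x : V), 0 < c -> x != 0 -> g (c *: x) = g x.
Hypothesis g_gt0 : forall x, x != 0 -> 0 < g x.

Lemma sqn_ge x : `|x| ^+ 2 <= sqn x.
Proof.
rewrite -(@sqr_sqrtr _ (sqn x)); last by apply: sumr_ge0 => k _; exact: sqr_ge0.
rewrite ler_sqr ?nnegrE ?sqrtr_ge0 //; apply: norm_le_coord; first exact: sqrtr_ge0.
move=> j; rewrite -sqrtr_sqr ler_sqrt; last by apply: sumr_ge0 => k _; exact: sqr_ge0.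
rewrite /sqn (bigD1 j) //= lerDl; apply: sumr_ge0 => k _; exact: sqr_ge0.
Qed.

Lemma sqn_le x : sqn x <= m.+1%:R * `|x| ^+ 2.
Proof.
have -> : m.+1%:R * `|x| ^+ 2 = \sum_(k < m.+1) `|x| ^+ 2.
  by rewrite sumr_const card_ord mulr_natl.
apply: ler_sum => k _; rewrite -[_ ^+ 2]ger0_norm ?sqr_ge0 // normrX.
by rewrite ler_sqr ?nnegrE // coord_le_norm.
Qed.

Let S : set V := [set x | sqn x = 1].

(** Extreme values on the compact Euclidean unit sphere, spread by homogeneity. *)
Lemma gauge_bounds : exists c1 c2, 0 < c1 /\ forall x, x != 0 -> c1 <= g x <= c2.
Proof.
have S_neq0 x : S x -> x != 0.
  move=> Sx; apply/eqP => x0; move: Sx; rewrite /S /= x0 /sqn.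
  under eq_bigr => k _ do rewrite mxE expr0n.
  by rewrite big1 // => /eqP; rewrite eq_sym oner_eq0.
have cS : compact S.
  apply: bounded_closed_compact.
    exists 1; split => // M M1 x Sx; apply: le_trans (ltW M1).
    have := sqn_ge x; rewrite Sx -[leRHS](expr1n _ 2) ler_sqr ?nnegrE //.
  have -> : S = (@sqn R m) @^-1` [set 1] by [].
  apply: closed_comp; last exact: closed_eq.
  by move=> x _; have [cs _] := @sqn_C1 R m (fun=> True) x I; exact: cs.
have S0 : S !=set0.
  exists (unitv R ord0); rewrite /S /= /sqn (bigD1 ord0) //= mxE eqxx expr1n.
  by rewrite big1 ?addr0 // => k k0; rewrite mxE (negbTE k0) andbF expr0n.
have gS : {within S, continuous g}.
  by apply: continuous_in_subspaceT => x /set_mem Sx; apply: g_cont; exact: S_neq0.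
have [xM SM HM] := EVT_max_rV S0 cS gS.
have [xm Sm Hm] := EVT_min_rV S0 cS gS.
exists (g xm), (g xM); split; first by apply: g_gt0; apply: S_neq0; exact: set_mem.
move=> x x0; have s0 := sqn_gt0 x0.
have r0 : 0 < (Num.sqrt (sqn x))^-1 by rewrite invr_gt0 sqrtr_gt0.
rewrite -(g_homog r0 x0).
have Sy : S ((Num.sqrt (sqn x))^-1 *: x).
  by rewrite /S /= sqnZ exprVn sqr_sqrtr ?ltW // mulVf // gt_eqF.
by rewrite Hm ?HM //; exact: mem_set.
Qed.

Lemma gauge2_bounds : exists rho M, [/\ 0 < rho, 0 < M,
  forall x, `|x| < rho -> gauge2 g x <= 1 / 2 &
  forall x, M / 4 <= `|x| -> 2 <= gauge2 g x].
Proof.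
have [c1 [c2 [c10 H]]] := gauge_bounds.
have c20 : 0 < c2.
  have u0 : unitv R ord0 != 0 :> V.
    by apply/eqP => /rowP /(_ ord0); rewrite !mxE eqxx; apply/eqP; exact: oner_neq0.
  by have /andP[h1 h2] := H _ u0; exact: lt_le_trans (le_trans h1 h2).
have m0 : 0 < m.+1%:R :> R by [].
(* By [sqn_le], the first radius gives [gauge2 <= 1 / (4 * m.+1)]; by [sqn_ge], [M / 4 = 2 / c1]
   gives [gauge2 >= 4]. So [bump] of the gauge lives in an annulus. *)
exists (2 * m.+1%:R * c2)^-1, (8 / c1); split.
- by rewrite invr_gt0 !mulr_gt0.
- by rewrite divr_gt0.
- move=> x xr; have [->|x0] := eqVneq x 0.
    rewrite /gauge2 /sqn big1 ?mul0r // => k _; by rewrite mxE expr0n.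
  have /andP[h1 h2] := H x x0.
  have sx := sqn_le x.
  have g2 : g x ^+ 2 <= c2 ^+ 2 by rewrite ler_sqr ?nnegrE //; lra.
  have xr' : `|x| * (2 * m.+1%:R * c2) < 1.
    by rewrite -ltr_pdivlMr ?mulr_gt0 // div1r.
  have m1 : 1 <= m.+1%:R :> R by rewrite ler1n.
  apply: (@le_trans _ _ (m.+1%:R * `|x| ^+ 2 * c2 ^+ 2)).
    by apply: ler_pM => //; rewrite ?sqr_ge0 // ltW // sqn_gt0.
  set a := m.+1%:R in m1 xr' *; set b := `|x| in xr' *.
  have b0 : 0 <= b by exact: normr_ge0.
  have : (b * (2 * a * c2)) ^+ 2 <= 1.
    have h0 : 0 <= b * (2 * a * c2) by rewrite !mulr_ge0 // ?(ltW c20) // (le_trans ler01 m1).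
    by rewrite expr_le1 //; exact: ltW.
  have -> : (b * (2 * a * c2)) ^+ 2 = 4 * a * (a * b ^+ 2 * c2 ^+ 2) by ring.
  have : 0 <= a * b ^+ 2 * c2 ^+ 2.
    by apply: mulr_ge0; [apply: mulr_ge0; [exact: le_trans ler01 m1 | exact: sqr_ge0] | exact: sqr_ge0].
  set z := a * b ^+ 2 * c2 ^+ 2; nra.
- move=> x xM.
  have xM' : 2 / c1 <= `|x| by move: xM; have -> : 8 / c1 / 4 = 2 / c1 by field; rewrite gt_eqF.
  have x0 : x != 0 by rewrite -normr_gt0; apply: lt_le_trans xM'; rewrite divr_gt0.
  have /andP[h1 h2] := H x x0.
  have sx := sqn_ge x.
  apply: (@le_trans _ _ ((2 / c1) ^+ 2 * c1 ^+ 2)).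
    have -> : (2 / c1) ^+ 2 * c1 ^+ 2 = 4 by field; rewrite gt_eqF.
    lra.
  rewrite /gauge2; apply: ler_pM; rewrite ?sqr_ge0 //.
    apply: le_trans sx; rewrite ler_sqr ?nnegrE // divr_ge0 // ltW //.
  by rewrite ler_sqr ?nnegrE // ltW // g_gt0.
Qed.

End Bounds.

(** * The integral identity *)

Section Obstruction.
Variables (R : realType) (n : nat) (p : R) (phi dphi : R -> R).
Hypothesis phi_derive : forall s : R, is_derive s 1 phi (dphi s).
Hypothesis dphi_cont : continuous dphi.
Notation V := 'rV[R]_n.+1.
Notation l := (ord_max : 'I_n.+1).
Local Notation nz := (fun x : V => x != 0).
Implicit Types (x : V) (s w : R).

Lemma C1_inv (a : V -> R) (da : 'I_n.+1 -> V -> R) :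
  C1_on nz a da -> (forall x, x != 0 -> a x != 0) ->
  C1_on nz (fun x => (a x)^-1) (fun i x => - ((a x)^-1 * (a x)^-1) * da i x).
Proof.
move=> Ca a0.
have D (s : R) : s != 0 -> is_derive s 1 (fun s : R => s^-1) (- (s^-1 * s^-1)).
  move=> s0; have := @is_deriveV R id s 1 1 s0 (is_derive_id _ _).
  by rewrite [_ *: _]mulr1 /= expr2 invfM.
apply: (@C1_comp _ _ nz (fun s : R => s^-1) (fun s => - (s^-1 * s^-1)) a da Ca) => x x0.
split; first by apply: D; exact: a0.
have c : {for a x, continuous (fun s : R => s^-1)}.
  exact: derivable_continuous (D _ (a0 _ x0)).
exact: continuousN (continuousM c c).
Qed.

Variable h : V -> R.
Hypothesis h_sol : Lp_Minkowski_solution p (fun x => phi (x 0 l ^+ 2)) h.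

Let g := ext0 h.
Let e := n%:R + 1 + p.
Local Notation G k := (pd k g).

Lemma dotv_sqn (x : V) : dotv x x = sqn x.
Proof. by rewrite /dotv mxE; apply: eq_bigr => k _; rewrite mxE -expr2. Qed.

Lemma enorm_gt0 x : x != 0 -> 0 < enorm x.
Proof. by move=> x0; rewrite /enorm dotv_sqn sqrtr_gt0 sqn_gt0. Qed.

Lemma sphere_normalize x : x != 0 -> on_sphere ((enorm x)^-1 *: x).
Proof.
move=> x0; have s0 := sqn_gt0 x0.
rewrite /on_sphere dotv_sqn sqnZ exprVn /enorm dotv_sqn sqr_sqrtr ?ltW //.
by rewrite mulVf // gt_eqF.
Qed.

Lemma ext0_homog (c : R) x : 0 < c -> x != 0 -> g (c *: x) = g x.
Proof.
move=> c0 x0; rewrite /g /ext0; congr h.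
have -> : enorm (c *: x) = c * enorm x.
  rewrite /enorm !dotv_sqn sqnZ sqrtrM ?sqr_ge0 // sqrtr_sqr gtr0_norm //.
rewrite scalerA; congr (_ *: _); have := enorm_gt0 x0 => E0.
by field; rewrite !gt_eqF.
Qed.

Lemma ext0_gt0 x : x != 0 -> 0 < g x.
Proof. by move=> x0; have [h0 _] := h_sol; apply: h0; exact: sphere_normalize. Qed.

Lemma ext0_C2 : C2_nonzero g.
Proof. by have [_ []] := h_sol. Qed.

Definition ratio x : R := x 0 l * x 0 l * (sqn x)^-1.
Definition dratio i x : R :=
  x 0 l * x 0 l * (- ((sqn x)^-1 * (sqn x)^-1) * (2 * x 0 i)) +
  (sqn x)^-1 * (x 0 l * (l == i)%:R + x 0 l * (l == i)%:R).

Lemma ratio_C1 : C1_on nz ratio dratio.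
Proof.
apply: (C1M (C1M (@C1_coord R n nz l) (@C1_coord R n nz l)) (C1_inv (@sqn_C1 R n nz) _)).
by move=> x x0; rewrite gt_eqF // sqn_gt0.
Qed.

(** The function [J], the extension of degree 0 of [f h^e]. *)
Definition density x : R := phi (ratio x) * powR (g x) e.
Definition ddensity i x : R :=
  phi (ratio x) * (e * powR (g x) (e - 1) * G i x) + powR (g x) e * (dphi (ratio x) * dratio i x).

Lemma density_C1 : C1_on nz density ddensity.
Proof.
apply: C1M.
  by apply: (C1_comp ratio_C1) => x _; split; [exact: phi_derive | exact: dphi_cont].
apply: (@C1_comp _ _ nz (fun s => powR s e) (fun s => e * powR s (e - 1)) g _ (g_C1 ext0_C2)).
move=> x x0; have g0 := ext0_gt0 x0; split; first exact: is_derive1_powR.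
have c1 : {for g x, continuous (fun _ : R => e)} by exact: cst_continuous.
have c2 : {for g x, continuous (fun s => powR s (e - 1))}.
  exact: derivable_continuous (is_derive1_powR (e - 1) g0).
exact: (continuousM c1 c2).
Qed.

(** Both sides have degree 0, so the identity is checked on the sphere, where the equation turns
    [g ^+ n.+2 * g^(p - 1)] into [g^e]. *)
Lemma det_half_hess x : x != 0 -> \det (\matrix_(k, j) half_hess g k j x) = density x.
Proof.
move=> x0; set y := (enorm x)^-1 *: x.
have c0 : 0 < (enorm x)^-1 by rewrite invr_gt0 enorm_gt0.
have yS : on_sphere y by exact: sphere_normalize.
have y0 : y != 0 by rewrite scaler_eq0 negb_or (gt_eqF c0).
have gy : g y = g x by exact: ext0_homog.
have hy : h y = g y by rewrite gy.
have [E frE] := orth_frame_exists yS.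
have [_ [_ /(_ y E yS frE)[_ dcov]]] := h_sol.
have sy : sqn y = 1 by rewrite -dotv_sqn.
have gy0 : g y != 0 by rewrite gt_eqF // ext0_gt0.
have -> : \matrix_(k, j) half_hess g k j x = (g y ^+ 2)%:M
   + (2 * g y) *: (y^T *m (\row_j G j y)) + (2 * g y) *: ((\row_j G j y)^T *m y)
   + ((\row_j G j y)^T *m (\row_j G j y) + g y *: hessmx g y).
  apply/matrixP => k j; rewrite mxE -(half_hess_homog ext0_C2 ext0_homog k j c0 x0) -/y.
  clearbody y; rewrite !mxE !big_ord1 !mxE /half_hess sy.
  move: (pd j (pd k g) y) (pd j g y) (pd k g y) (g y) => H Gj Gk c.
  by case: (k == j); rewrite ?mulr1n ?mulr0n /=; ring.
rewrite (det_gauge_hessian gy0 yS frE).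
- have -> : E^T *m hessmx g y *m E + (g y)%:M = cov_mx h y E by rewrite /cov_mx hy.
  rewrite dcov hy gy mulrCA /density; congr (phi _ * _).
    by rewrite /ratio /y !mxE exprMn exprVn /enorm dotv_sqn sqr_sqrtr ?ltW ?sqn_gt0 //; ring.
  have g0 := ext0_gt0 x0.
  rewrite -powR_mulrn ?ltW // -powRD; last by rewrite (gt_eqF g0) implybT.
  by congr powR; rewrite /e -natr1 -[n.+1%:R]natr1; ring.
- clearbody y; apply/matrixP => i j; rewrite [LHS]mxE [RHS]mxE.
  rewrite -[RHS](euler_g ext0_C2 ext0_homog y0).
  by apply: eq_bigr => k _; rewrite !mxE !ord1 mulrC.
- clearbody y; apply/rowP => j; transitivity (- G j y); last by rewrite !mxE.
  rewrite [LHS]mxE -[RHS](euler_grad ext0_C2 ext0_homog j y0).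
  by apply: eq_bigr => k _; rewrite !mxE.
- clearbody y; apply/colP => j; transitivity (- G j y); last by rewrite !mxE.
  rewrite [LHS]mxE -[RHS](euler_G ext0_C2 ext0_homog j y0).
  by apply: eq_bigr => k _; rewrite !mxE mulrC.
Qed.

(** The function [L = x_l Y_l J / w] with the division by [w] carried out; its degree 0 is then
    visible. *)
Definition axial x : R := density x * (ratio x + x 0 l * (G l x * (g x)^-1)).

Lemma axial_C1 : exists daxial, C1_on nz axial daxial.
Proof.
eexists; apply: (C1M density_C1 (C1D ratio_C1 (C1M (@C1_coord R n nz l)
  (C1M (G_C1 ext0_C2 l) (C1_inv (g_C1 ext0_C2) _))))).
by move=> x x0; rewrite gt_eqF // ext0_gt0.
Qed.

Lemma ratioZ (c : R) x : 0 < c -> x != 0 -> ratio (c *: x) = ratio x.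
Proof.
move=> c0 x0; have s0 := sqn_gt0 x0; rewrite /ratio sqnZ !mxE.
by field; rewrite !gt_eqF.
Qed.

Lemma axial_homog (c : R) x : 0 < c -> x != 0 -> axial (c *: x) = axial x.
Proof.
move=> c0 x0; rewrite /axial /density (ratioZ c0 x0) (ext0_homog c0 x0).
rewrite (G_homog ext0_C2 ext0_homog l c0 x0) !mxE; congr (_ * (_ + _)).
have g0 := ext0_gt0 x0.
by field; rewrite !gt_eqF.
Qed.

Lemma axialE x : x != 0 -> gauge2 g x * axial x = x 0 l * half_grad g l x * density x.
Proof.
move=> x0; rewrite /axial /gauge2 /half_grad /ratio.
have s0 := sqn_gt0 x0; have g0 := ext0_gt0 x0.
by field; rewrite !gt_eqF.
Qed.

Definition cutoff x : R := bump (gauge2 g x).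
Definition dcutoff i x : R := dbump (gauge2 g x) * (2 * half_grad g i x).

Lemma cutoff_C1 : C1_on nz cutoff dcutoff.
Proof.
apply: (C1_comp (gauge2_C1 ext0_C2)) => x _; split; first exact: is_derive_bump.
exact: dbump_continuous.
Qed.

Lemma outer_C1 : C1_on nz (fun x => plateau (gauge2 g x))
  (fun i x => dplateau (gauge2 g x) * (2 * half_grad g i x)).
Proof.
apply: (C1_comp (gauge2_C1 ext0_C2)) => x _; split; first exact: is_derive_plateau.
exact: dplateau_continuous.
Qed.

Variables (rho M : R).
Hypotheses (rho0 : 0 < rho) (M0 : 0 < M).
Hypothesis gauge2_small : forall x, `|x| < rho -> gauge2 g x <= 1 / 2.
Hypothesis gauge2_large : forall x, M / 4 <= `|x| -> 2 <= gauge2 g x.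

Lemma cutoff_small x : `|x| < rho -> cutoff x = 0 /\ forall i, dcutoff i x = 0.
Proof.
move=> xr; have w := gauge2_small xr.
have [|b db] := @bump_out R (gauge2 g x); first by apply/negP => /andP[]; lra.
by rewrite /cutoff /dcutoff b db; split => // i; rewrite mul0r.
Qed.

Lemma cutoff_far x : M / 4 <= `|x| -> cutoff x = 0.
Proof.
move=> xM; have w := gauge2_large xM.
by have [|b _] := @bump_out R (gauge2 g x); first by apply/negP => /andP[]; lra.
Qed.

Lemma cutoffM_C1 (a : V -> R) (da : 'I_n.+1 -> V -> R) : C1_on nz a da ->
  C1_on (fun=> True) (fun x => cutoff x * a x)
    (fun i x => cutoff x * da i x + a x * dcutoff i x).
Proof.
move=> Ca; apply: (C1_extend rho0 (C1M cutoff_C1 Ca)) => x xr.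
have [c dc] := cutoff_small xr; rewrite c mul0r; split => // i.
by rewrite dc mul0r mulr0 addr0.
Qed.

(** The term with the derivative of the cutoff, common to the three identities that follow. *)
Let radial x : R := 2 * dbump (gauge2 g x) * gauge2 g x * axial x.

(** The Jacobian of [Y] with [Y_l] multiplied by the cutoff [X] is [X J + 2 X' x_l Y_l J], and
    [x_l Y_l J = w L]. *)
Lemma null_hessian : null_mean M (fun x => cutoff x * density x + radial x).
Proof.
pose a k x := if k == l then cutoff x * half_grad g l x
              else plateau (gauge2 g x) * half_grad g k x.
pose da k j x := if k == l then cutoff x * half_hess g l j x + half_grad g l x * dcutoff j x
  else plateau (gauge2 g x) * half_hess g k j x +
       half_grad g k x * (dplateau (gauge2 g x) * (2 * half_grad g j x)).
have Ca k : C1_on (fun=> True) (a k) (da k).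
  rewrite /a /da; case: eqP => [_|_]; first exact: (cutoffM_C1 (half_grad_C1 ext0_C2 l)).
  apply: (C1_extend rho0 (C1M outer_C1 (half_grad_C1 ext0_C2 k))) => x xr.
  have [c dc] := plateau_zero (gauge2_small xr).
  by rewrite c dc !mul0r; split => // i; rewrite !mul0r mulr0 addr0.
have supp y : M / 4 <= `|y| -> a l y = 0.
  by move=> yM; rewrite /a eqxx cutoff_far // mul0r.
have := null_mean_det_row M0 Ca supp; congr (null_mean M _); apply/funext => x.
have [wx|wx] := boolP (1 < gauge2 g x < 2); last first.
  have [b db] := bump_out wx.
  have da0 j : da l j x = 0 by rewrite /da eqxx /cutoff /dcutoff b db !mul0r mulr0 addr0.
  rewrite /radial /cutoff b db mulr0 !mul0r addr0 (expand_det_row _ l) big1 // => j _.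
  by rewrite [X in X * _]mxE da0 mul0r.
have x0 : x != 0.
  apply/eqP => xz; move: wx; rewrite xz /gauge2 /sqn big1 ?mul0r //.
    by move=> /andP[]; lra.
  by move=> k _; rewrite mxE expr0n.
have [pl dpl] : plateau (gauge2 g x) = 1 /\ dplateau (gauge2 g x) = 0.
  by apply: plateau_one; move: wx => /andP[/ltW].
(* On the support of the cutoff, grad w = 2 Y is a combination of the rows of DY, so the new matrix
   is DY times an identity with one altered row. *)
have -> : \matrix_(k, j) da k j x =
    (\matrix_(k, j) (if k == l then cutoff x * (l == j)%:R
       + 2 * dbump (gauge2 g x) * half_grad g l x * x 0 j else (k == j)%:R))
    *m (\matrix_(k, j) half_hess g k j x).
  apply/matrixP => k j; rewrite [LHS]mxE [RHS]mxE /da.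
  under eq_bigr => i _ do rewrite [X in X * _]mxE [X in _ * X]mxE.
  case: (k == l).
    rewrite (eq_bigr (fun i => cutoff x * ((l == i)%:R * half_hess g i j x)
      + 2 * dbump (gauge2 g x) * half_grad g l x * (x 0 i * half_hess g i j x)));
      last by move=> i _; ring.
    rewrite big_split /= -!mulr_sumr (half_grad_row ext0_C2 ext0_homog j x0).
    rewrite (bigD1 l) //= eqxx mul1r big1 ?addr0 /dcutoff.
      by move: (half_hess g l j x) (half_grad g l x) (half_grad g j x) => a1 a2 a3; ring.
    by move=> i /negbTE il; rewrite eq_sym il mul0r.
  rewrite (bigD1 k) //= eqxx mul1r big1.
    by rewrite pl dpl mul1r mul0r mulr0.
  by move=> i /negbTE ik; rewrite eq_sym ik mul0r.
rewrite det_mulmx det_id_row det_half_hess // eqxx mulr1 /radial.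
rewrite -[2 * _ * _ * axial x]mulrA axialE //; ring.
Qed.

(** The partial derivative of [X x_l J] along the axis; the derivative of [X] contributes
    [2 X' Y_l x_l J]. *)
Lemma null_axial : null_mean M (fun x =>
  cutoff x * (density x + x 0 l * ddensity l x) + radial x).
Proof.
have C := cutoffM_C1 (C1M (@C1_coord R n nz l) density_C1).
have := null_mean_partial M0 l C _.
have supp y : M / 4 <= `|y| -> cutoff y * (y 0 l * density y) = 0.
  by move=> yM; rewrite cutoff_far // mul0r.
move=> /(_ supp); congr (null_mean M _); apply/funext => x.
rewrite eqxx mulr1 /dcutoff /radial.
have [->|x0] := eqVneq x 0.
  have [|b db] := @bump_out R (gauge2 g 0).
    have := @gauge2_small 0; rewrite normr0 => /(_ rho0) w; apply/negP => /andP[]; lra.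
  by rewrite /cutoff b db !mul0r !mulr0 !mul0r.
rewrite -[2 * _ * _ * axial x]mulrA axialE //; ring.
Qed.

(** The divergence of [X L x]: the radial derivative of [L] is zero by degree 0, and [x . Y = w]. *)
Lemma null_euler : null_mean M (fun x => n.+1%:R * cutoff x * axial x + radial x).
Proof.
have [daxial CL] := axial_C1.
have C k := cutoffM_C1 (C1M CL (@C1_coord R n nz k)).
have supp k y : M / 4 <= `|y| -> cutoff y * (axial y * y 0 k) = 0.
  by move=> yM; rewrite cutoff_far // mul0r.
have := null_mean_sum (index_enum 'I_n.+1) (fun k => null_mean_partial M0 k (C k) (supp k)).
congr (null_mean M _); apply/funext => x.
have [->|x0] := eqVneq x 0.
  have z : `|0 : V| < rho by rewrite normr0.
  have [c dc] := cutoff_small z.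
  have [|b db] := @bump_out R (gauge2 g 0).
    by have w := gauge2_small z; apply/negP => /andP[]; lra.
  rewrite big1 => [|k _]; first by rewrite /radial c db !mulr0 !mul0r addr0.
  by rewrite c dc mul0r mulr0 addr0.
have one_derive : is_derive (1 : R) 1 (fun _ : R => 1 : R) 0 by exact: is_derive_cst.
have EL : \sum_k x 0 k * daxial k x = 0.
  rewrite (euler_homogeneous CL (theta := fun=> 1) _ one_derive x0) ?mul0r //.
  by move=> c y c0 y0; rewrite mul1r axial_homog.
rewrite (eq_bigr (fun k => cutoff x * axial x + cutoff x * (x 0 k * daxial k x)
   + 2 * dbump (gauge2 g x) * axial x * (x 0 k * half_grad g k x))); last first.
  by move=> k _; rewrite eqxx mulr1 /dcutoff; ring.
rewrite /radial; move: (axial x) => A; rewrite !big_split /= -!mulr_sumr EL.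
rewrite (sum_half_grad ext0_C2 ext0_homog x0) sumr_const card_ord -mulr_natl; ring.
Qed.

Definition bracket s : R :=
  e * (s - n.+1%:R^-1) * phi s - 2 * s * (1 - s) * dphi s.

(* The weights are chosen to cancel the terms containing the derivative of the
   cutoff and the partial derivative of [g]. *)
Lemma null_bracket : null_mean M (fun x => cutoff x * powR (g x) e * bracket (ratio x)).
Proof.
(* The weights [1 - b], [-1], [b] sum to zero, which removes [radial], and [b * n.+1 = e] matches
   the two terms in [x_l G_l / g]. *)
pose b := e / n.+1%:R.
have := null_meanD (null_meanZ (1 - b) null_hessian)
  (null_meanD (null_meanZ (-1) null_axial) (null_meanZ b null_euler)).
congr (null_mean M _); apply/funext => x.
have m0 : n.+1%:R != 0 :> R by rewrite pnatr_eq0.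
have [->|x0] := eqVneq x 0.
  have z : `|0 : V| < rho by rewrite normr0.
  have [c dc] := cutoff_small z; rewrite c /b; ring.
have s0 := sqn_gt0 x0; have g0 := ext0_gt0 x0.
have powE : powR (g x) (e - 1) = powR (g x) e / g x.
  by rewrite powRD ?(gt_eqF g0) ?implybT // powR_inv1 // ltW.
rewrite /ddensity /axial /density /bracket powE.
have dr : x 0 l * dratio l x = 2 * ratio x * (1 - ratio x).
  by rewrite /dratio /ratio eqxx !mulr1; field; rewrite gt_eqF.
set W := radial x; set P := phi (ratio x); set D := dphi (ratio x).
set Q := powR (g x) e; set X := cutoff x; set r := ratio x in dr *.
have -> : x 0 l * (P * (e * (Q / g x) * G l x) + Q * (D * dratio l x)) =
  P * e * Q * (x 0 l * (G l x * (g x)^-1)) + Q * D * (2 * r * (1 - r)).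
  by rewrite -dr; field; rewrite gt_eqF.
set Z := x 0 l * (G l x * (g x)^-1).
by rewrite /b; field.
Qed.

End Obstruction.

(** A solution would make the mean of a nonnegative function vanish, although this function is
    positive at a point where [ratio] is 1/2 and [gauge2] is 3/2. *)
Lemma bracket_obstruction (R : realType) (n : nat) (p : R) (phi dphi : R -> R) :
  (0 < n)%N ->
  (forall s : R, is_derive s 1 phi (dphi s)) -> continuous dphi ->
  (forall s, 0 <= s <= 1 -> 0 <= bracket n p phi dphi s) ->
  0 < bracket n p phi dphi (1 / 2) ->
  ~ exists h : 'rV[R]_n.+1 -> R,
      Lp_Minkowski_solution p (fun x => phi (x 0 ord_max ^+ 2)) h.
Proof.
move=> n0 phiD dphiC B0 B12 [h sol].
pose g := ext0 h.
have gC2 := ext0_C2 sol; have gpos := ext0_gt0 sol.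
have ghom : forall (c : R) (x : 'rV_n.+1), 0 < c -> x != 0 -> g (c *: x) = g x.
  exact: (@ext0_homog R n h).
have gcont (x : 'rV[R]_n.+1) : x != 0 -> {for x, continuous g}.
  by move=> x0; have [] := gC2 x x0.
have [rho [M [rho0 M0 small large]]] := gauge2_bounds gcont ghom gpos.
have nb := null_bracket phiD dphiC sol rho0 M0 small large.
(* As [n] is positive, the two axes differ and [u] is halfway between pole and equator. *)
pose u : 'rV[R]_n.+1 := unitv R ord0 + unitv R ord_max.
have l0 : (ord0 : 'I_n.+1) != ord_max by rewrite -val_eqE /=; move: n0; case: (n).
have ul : u 0 ord_max = 1 by rewrite /u !mxE !eqxx /= [_ == ord0]eq_sym (negbTE l0) add0r.
have u_neq0 : u != 0.
  by apply/eqP => /rowP /(_ ord_max); rewrite ul mxE; apply/eqP; exact: oner_neq0.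
have su : sqn u = 2.
  rewrite /sqn (bigD1 ord_max) //= (bigD1 ord0) //= ul big1 => [|k /andP[k1 k2]].
    by rewrite /u !mxE !eqxx (negbTE l0) /= !addr0 !expr1n.
  by rewrite !mxE (negbTE k1) (negbTE k2) !andbF addr0 expr0n.
have gu := gpos u u_neq0.
(* Since [sqn u = 2], this scaling puts [gauge2] at 3/2, the middle of the support of [bump]. *)
pose c := Num.sqrt (3 / 4) / g u.
have c0 : 0 < c by rewrite divr_gt0 // sqrtr_gt0 divr_gt0.
pose x0 := c *: u.
have x0_neq0 : x0 != 0 by rewrite scaler_eq0 negb_or (gt_eqF c0).
have rx0 : ratio x0 = 1 / 2 by rewrite ratioZ // /ratio ul su mulr1.
have wx0 : gauge2 g x0 = 3 / 2.
  rewrite /gauge2 sqnZ su (ghom c u c0 u_neq0) /c exprMn sqr_sqrtr ?divr_ge0 //.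
  by field; rewrite gt_eqF.
have rin (x : 'rV[R]_n.+1) : x != 0 -> 0 <= ratio x <= 1.
  move=> xn; have s0 := sqn_gt0 xn.
  rewrite /ratio -expr2 divr_ge0 ?sqr_ge0 ?(ltW s0) //= ler_pdivrMr // mul1r.
  rewrite /sqn (bigD1 ord_max) //= lerDl; apply: sumr_ge0 => k _; exact: sqr_ge0.
apply: (not_null_mean_ge0 M0 (x0 := x0) _ _ _ _ nb).
- move=> x; have [->|xn] := eqVneq x 0.
    have z : `|0 : 'rV[R]_n.+1| < rho by rewrite normr0.
    by have [cz _] := cutoff_small small z; rewrite cz !mul0r.
  apply: mulr_ge0; last by apply: B0; exact: rin.
  by apply: mulr_ge0; [exact: bump_ge0 | exact: powR_ge0].
- have [c1 _] := cutoff_C1 sol x0_neq0.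
  have [c2 _] := ratio_C1 x0_neq0.
  have c3 := gcont x0 x0_neq0.
  have c4 : {for x0, continuous (fun x => powR (g x) (n%:R + 1 + p))}.
    apply: (@continuous_comp _ _ _ g (fun s => powR s (n%:R + 1 + p))) => //.
    exact: derivable_continuous (is_derive1_powR _ (gpos x0 x0_neq0)).
  have c5 : {for x0, continuous (fun x => phi (ratio x))}.
    apply: (@continuous_comp _ _ _ (@ratio R n) phi) => //.
    exact: derivable_continuous (phiD _).
  have c6 : {for x0, continuous (fun x => dphi (ratio x))}.
    by apply: (@continuous_comp _ _ _ (@ratio R n) dphi) => //; exact: dphiC.
  have k (a : R) : {for x0, continuous (fun _ : 'rV[R]_n.+1 => a)} by exact: cst_continuous.
  have c7 := continuousB (continuousM (continuousM (k (n%:R + 1 + p))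
    (continuousB c2 (k n.+1%:R^-1))) c5)
    (continuousM (continuousM (continuousM (k 2) c2) (continuousB (k 1) c2)) c6).
  exact: (continuousM (continuousM c1 c4) c7).
- rewrite rx0; apply: mulr_gt0 => //; apply: mulr_gt0; last exact: powR_gt0 (gpos x0 x0_neq0).
  by rewrite /cutoff wx0 bump_3_2.
- move=> j; apply: (le_lt_trans (coord_le_norm _ _)).
  rewrite ltNge; apply/negP => xM.
  have : M / 4 <= `|x0| by apply: le_trans xM; move: M0; lra.
  by move/large; rewrite wx0; lra.
Qed.

(** * The two densities *)

Section Densities.
Variables (R : realType) (n : nat).
Notation V := 'rV[R]_n.+1.
Notation l := (ord_max : 'I_n.+1).
Implicit Types x y : V.

Lemma coord_le_enorm x k : `|x 0 k| <= enorm x.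
Proof.
rewrite /enorm dotv_sqn -sqrtr_sqr ler_sqrt; last by apply: sumr_ge0 => j _; exact: sqr_ge0.
by rewrite /sqn (bigD1 k) //= lerDl; apply: sumr_ge0 => j _; exact: sqr_ge0.
Qed.

Lemma sphere_coord_le1 x k : on_sphere x -> `|x 0 k| <= 1.
Proof.
by move=> xS; apply: (le_trans (coord_le_enorm x k)); rewrite /enorm xS sqrtr1.
Qed.

Lemma sphere_sqr_coord_le1 x k : on_sphere x -> x 0 k ^+ 2 <= 1.
Proof.
move=> /(sphere_coord_le1 k) x1; rewrite -[leRHS](expr1n _ 2) -[_ ^+ 2]ger0_norm ?sqr_ge0 //.
by rewrite normrX ler_sqr ?nnegrE.
Qed.

Lemma sphere_sqr_diff x y k : on_sphere x -> on_sphere y ->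
  `|x 0 k ^+ 2 - y 0 k ^+ 2| <= 2 * `|x 0 k - y 0 k|.
Proof.
move=> /(sphere_coord_le1 k) x1 /(sphere_coord_le1 k) y1.
rewrite subr_sqr normrM mulrC ler_wpM2r //.
by apply: (le_trans (ler_normD _ _)); lra.
Qed.

Lemma sphere_pole x : on_sphere x -> 1 <= x 0 l ^+ 2 ->
  x = unitv R l \/ x = - unitv R l.
Proof.
move=> xS xl.
have /eqP : sqn x = 1 by rewrite -dotv_sqn.
rewrite /sqn (bigD1 l) //= => /eqP sx.
have s0 : 0 <= \sum_(i < n.+1 | i != l) x 0 i ^+ 2 by apply: sumr_ge0 => k _; exact: sqr_ge0.
have z0 : \sum_(i < n.+1 | i != l) x 0 i ^+ 2 = 0 by lra.
have x0 k : k != l -> x 0 k = 0.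
  move=> kl; apply/eqP; rewrite -sqrf_eq0; apply/eqP.
  by have := psumr_eq0P (fun i _ => sqr_ge0 (x 0 i)) z0; apply.
have /eqP : x 0 l ^+ 2 = 1 by lra.
rewrite sqrf_eq1 => /orP[] /eqP xl1; [left | right]; apply/rowP => k; rewrite !mxE /=;
  have [->|kl] := eqVneq k l => //; rewrite x0 //; by rewrite oppr0.
Qed.

Lemma diff_expr_le (a b : R) j : 0 <= a <= 1 -> 0 <= b <= 1 ->
  `|a ^+ j - b ^+ j| <= j%:R * `|a - b|.
Proof.
move=> /andP[a0 a1] /andP[b0 b1]; elim: j => [|j IH].
  by rewrite !expr0 subrr normr0 mul0r.
have -> : a ^+ j.+1 - b ^+ j.+1 = a * (a ^+ j - b ^+ j) + (a - b) * b ^+ j.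
  by rewrite !exprS; ring.
apply: (le_trans (ler_normD _ _)); rewrite -natr1 [leRHS]mulrDl mul1r lerD // normrM.
  by apply: le_trans IH; rewrite ler_piMl // ger0_norm.
by rewrite ler_piMr // ger0_norm ?exprn_ge0 // exprn_ile1.
Qed.

End Densities.

Theorem theorem1p1 (R : realType) (n : nat) (hn : (1 <= n)%N) :
  (exists (alpha : R) (f : 'rV[R]_n.+1 -> R),
      0 < alpha < 1 /\ holder_sphere alpha f /\
      (forall x, on_sphere x -> 0 < f x) /\
      ~ (exists h, Lp_Minkowski_solution (- (n%:R + 1)) f h)) /\
  (forall p : R, p < - (n%:R + 1) ->
    exists (alpha : R) (f : 'rV[R]_n.+1 -> R),
      0 < alpha <= 1 /\ holder_sphere alpha f /\
      (forall x, on_sphere x -> x != unitv R ord_max -> x != - unitv R ord_max ->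
         0 < f x) /\
      ~ (exists h, Lp_Minkowski_solution p f h)).
Proof.
have D1 (a s : R) : is_derive s 1 (fun s : R => a - s) (-1).
  have := is_deriveB (is_derive_cst a s (1 : R)) (is_derive_id s (1 : R)).
  by rewrite sub0r.
split.
  exists (1 / 2), (fun x => 2 - x 0 ord_max ^+ 2); split; first lra.
  split.
    (* The difference is at most [2 * d] and at most 1, so its square is at most [2 * d], below
       [(2 * sqrt d) ^+ 2]. *)
    exists 2 => x y xS yS; set d := enorm (x - y).
    have -> : 2 - x 0 ord_max ^+ 2 - (2 - y 0 ord_max ^+ 2) =
      - (x 0 ord_max ^+ 2 - y 0 ord_max ^+ 2) by ring.
    rewrite normrN.
    have h1 := sphere_sqr_diff ord_max xS yS.
    have h2 : `|x 0 ord_max - y 0 ord_max| <= d.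
      by have := coord_le_enorm (x - y) ord_max; rewrite !mxE.
    have h3 : `|x 0 ord_max ^+ 2 - y 0 ord_max ^+ 2| <= 1.
      have a1 := sphere_sqr_coord_le1 ord_max xS; have a2 := sqr_ge0 (x 0 ord_max).
      have b1 := sphere_sqr_coord_le1 ord_max yS; have b2 := sqr_ge0 (y 0 ord_max).
      by rewrite ler_norml; lra.
    have d0 : 0 <= d by exact: sqrtr_ge0.
    rewrite div1r powR12_sqrt //.
    have sd : Num.sqrt d ^+ 2 = d by rewrite sqr_sqrtr.
    have s0 := sqrtr_ge0 d.
    have D0 := normr_ge0 (x 0 ord_max ^+ 2 - y 0 ord_max ^+ 2).
    by nra.
  split.
    by move=> x xS; have := sphere_sqr_coord_le1 ord_max xS; lra.
  (* Here [e = 0] and the bracket is [2 * s * (1 - s)]. *)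
  apply: (@bracket_obstruction R n _ (fun s => 2 - s) (fun=> -1)) => //.
  - exact: cst_continuous.
  - move=> s /andP[s0 s1]; rewrite /bracket addrN mul0r mul0r sub0r.
    by have := mulr_ge0 s0 (_ : 0 <= 1 - s); rewrite subr_ge0 => /(_ s1); lra.
  - by rewrite /bracket addrN !mul0r sub0r; lra.
move=> p hp.
pose e := n%:R + 1 + p.
have e0 : e < 0 by rewrite /e; lra.
(* A positive exponent with [2 * j + e >= 0]: the bracket equals [(1 - s) ^+ j * (s * (2 * j + e) -
   e / n.+1)], whose last term is positive. *)
pose j := (Num.truncn (- e)).+1.
have je : - e < 2 * j%:R.
  have := truncnS_gt (- e); rewrite -/j.
  have : 0 <= j%:R :> R by []; lra.
exists 1, (fun x => (1 - x 0 ord_max ^+ 2) ^+ j); split; first lra.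
split.
  (* Lipschitz constant [j] from the power and 2 from the square of the coordinate. *)
  exists (j%:R * 2) => x y xS yS.
  rewrite powRr1; last exact: sqrtr_ge0.
  have unit_itv (z : 'rV[R]_n.+1) : on_sphere z -> 0 <= 1 - z 0 ord_max ^+ 2 <= 1.
    by move=> zS; have := sphere_sqr_coord_le1 ord_max zS; have := sqr_ge0 (z 0 ord_max); lra.
  apply: (le_trans (diff_expr_le j (unit_itv x xS) (unit_itv y yS))).
  rewrite -mulrA ler_wpM2l //.
  have -> : 1 - x 0 ord_max ^+ 2 - (1 - y 0 ord_max ^+ 2) =
      - (x 0 ord_max ^+ 2 - y 0 ord_max ^+ 2) by ring.
  rewrite normrN; apply: (le_trans (sphere_sqr_diff ord_max xS yS)).
  rewrite ler_wpM2l //.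
  by have := coord_le_enorm (x - y) ord_max; rewrite !mxE.
split.
  move=> x xS xN xS'; apply: exprn_gt0; rewrite subr_gt0 ltNge; apply/negP => x1.
  by have [xE|xE] := sphere_pole xS x1; [move: xN | move: xS']; rewrite xE eqxx.
apply: (@bracket_obstruction R n p (fun s => (1 - s) ^+ j)
  (fun s => j%:R * (1 - s) ^+ j.-1 * -1)) => //.
- move=> s.
  have <- : (fun s : R => 1 - s) ^+ j = (fun s => (1 - s) ^+ j) by rewrite exprfctE.
  exact: (is_deriveX j (D1 1 s)).
- move=> s.
  have c1 : {for s, continuous (fun s : R => 1 - s)}.
    exact: (@derivable_continuous R (fun s => 1 - s) _ _ (D1 1 s)).
  have c2 : {for s, continuous (fun s : R => (1 - s) ^+ j.-1)}.
    exact: (@continuous_comp _ _ _ (fun s : R => 1 - s) (fun s => s ^+ j.-1) s c1 (@exprn_continuous _ _ _)).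
  have k (a : R) : {for s, continuous (fun _ : R => a)} by exact: cst_continuous.
  exact: (continuousM (continuousM (k j%:R) c2) (k (-1))).
- move=> s /andP[s0 s1].
  have -> : bracket n p (fun s => (1 - s) ^+ j) (fun s => j%:R * (1 - s) ^+ j.-1 * -1) s =
     (1 - s) ^+ j * (s * (2 * j%:R + e) + - e / n.+1%:R).
    rewrite /bracket -/e /j /= exprS; field; by rewrite nat1r pnatr_eq0.
  have je' : 0 <= 2 * j%:R + e by lra.
  apply: mulr_ge0; first by rewrite exprn_ge0 // subr_ge0.
  apply: addr_ge0; first exact: mulr_ge0.
  by rewrite divr_ge0 // oppr_ge0 ltW.
- have -> : bracket n p (fun s => (1 - s) ^+ j) (fun s => j%:R * (1 - s) ^+ j.-1 * -1) (1 / 2) =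
     (1 - 1 / 2) ^+ j * (1 / 2 * (2 * j%:R + e) + - e / n.+1%:R).
    rewrite /bracket -/e /j /= exprS; field; by rewrite nat1r pnatr_eq0.
  apply: mulr_gt0; first by apply: exprn_gt0; lra.
  apply: addr_gt0; first by lra.
  by rewrite divr_gt0 // oppr_gt0.
Qed.
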